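(* Let $(R,\mathfrak{m},k)$ be a Noetherian local domain and $\varphi$ a finite local self-map of $R$. Then (a) $\log\deg(\varphi)\le\log[\varphi_*k:k]+h_{\mathrm{alg}}(\varphi,R)$; (b) if in addition $R$ is Cohen–Macaulay, then $\log\deg(\varphi)=\log[\varphi_*k:k]+h_{\mathrm{alg}}(\varphi,R)$.
   Context: ''Finite'' means $R$ is a finitely generated module via $\varphi$; such a local self-map $\varphi$ has $\varphi(\mathfrak{m})R$ $\mathfrak{m}$-primary. $\varphi_*R$ denotes $R$ as an $R$-module via $\varphi$; $\deg(\varphi)$ is the rank of $\varphi_*R$. $[\varphi_*k:k]$ is the dimension of the residue field $k$ as a $k$-vector space via $\varphi$. Put $\lambda(\varphi^n):=\ell_R(R/\varphi^n(\mathfrak{m})R)$; the algebraic entropy is $h_{\mathrm{alg}}(\varphi,R):=\lim_{n\to\infty}\frac1n\log\lambda(\varphi^n)$ (the limit exists). *)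

(* Defs.v *)
From HB Require Import structures.
From mathcomp Require Import all_boot all_order all_algebra.
From mathcomp Require Import boolp classical_sets reals topology normedtype sequences exp.
Set Implicit Arguments. Unset Strict Implicit. Unset Printing Implicit Defensive.
Import Order.TTheory GRing.Theory Num.Theory.
Import numFieldNormedType.Exports.
Local Open Scope classical_set_scope.
Local Open Scope ring_scope.

Section CommAlg.
Variable A : comNzRingType.

Definition is_ideal (I : set A) : Prop :=
  I 0 /\ (forall x y, I x -> I y -> I (x + y)) /\ (forall r x, I x -> I (r * x)).

Definition maximal_ideal (M : set A) : Prop :=
  is_ideal M /\ M <> setT /\
  (forall J, is_ideal J -> M `<=` J -> J = M \/ J = setT).

Definition prime_ideal (P : set A) : Prop :=
  is_ideal P /\ P <> setT /\ (forall x y, P (x * y) -> P x \/ P y).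

Definition ideal_of (S : set A) : set A :=
  [set x | exists (n : nat) (s : 'I_n -> A) (c : 'I_n -> A),
           (forall i, S (s i)) /\ x = \sum_(i < n) c i * s i].

Definition noetherian : Prop :=
  forall I, is_ideal I -> exists (n : nat) (s : 'I_n -> A), I = ideal_of [set s i | i in setT].

Definition is_max (P : nat -> Prop) (n : nat) : Prop := P n /\ (forall k, P k -> (k <= n)%N).

Definition natmax (P : nat -> Prop) : nat :=
  match pselect (exists n, is_max P n) with
  | left h => projT1 (cid h)
  | right _ => 0%N
  end.

Definition ideal_chain_from (I : set A) (n : nat) : Prop :=
  exists J : nat -> set A, J 0%N = I /\ J n = setT /\
    (forall i, (i <= n)%N -> is_ideal (J i)) /\
    (forall i, (i < n)%N -> J i `<=` J i.+1 /\ J i <> J i.+1).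

(* length of the A-module A/I (submodules of A/I = ideals containing I) *)
Definition colength (I : set A) : nat := natmax (ideal_chain_from I).

Definition prime_chain (n : nat) : Prop :=
  exists P : nat -> set A, (forall i, (i <= n)%N -> prime_ideal (P i)) /\
    (forall i, (i < n)%N -> P i `<=` P i.+1 /\ P i <> P i.+1).

Definition regular_seq_in (m : set A) (n : nat) : Prop :=
  exists x : 'I_n -> A, (forall i, m (x i)) /\
    forall i : 'I_n, forall y,
      ideal_of [set x j | j in [set j : 'I_n | (j < i)%N]] (x i * y) ->
      ideal_of [set x j | j in [set j : 'I_n | (j < i)%N]] y.

Definition krull_dim_is (d : nat) : Prop := is_max prime_chain d.
Definition depth_is (m : set A) (d : nat) : Prop := is_max (regular_seq_in m) d.

Definition cohen_macaulay (m : set A) : Prop :=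
  exists d, krull_dim_is d /\ depth_is m d.

Definition finite_map (phi : A -> A) : Prop :=
  exists (n : nat) (s : 'I_n -> A),
    forall x, exists c : 'I_n -> A, x = \sum_(i < n) phi (c i) * s i.

(* rank of phi_* A: maximal number of phi-linearly independent elements *)
Definition phi_indep (phi : A -> A) (n : nat) : Prop :=
  exists r : 'I_n -> A, forall c : 'I_n -> A,
    \sum_(i < n) phi (c i) * r i = 0 -> forall i, c i = 0.
Definition deg (phi : A -> A) : nat := natmax (phi_indep phi).

(* [phi_* k : k], k = A/m acting on k via phi: maximal number of elements
   of A whose classes in k are linearly independent over k via phi *)
Definition res_indep (m : set A) (phi : A -> A) (n : nat) : Prop :=
  exists r : 'I_n -> A, forall c : 'I_n -> A,
    m (\sum_(i < n) phi (c i) * r i) -> forall i, m (c i).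
Definition res_deg (m : set A) (phi : A -> A) : nat := natmax (res_indep m phi).

Definition lambda (m : set A) (phi : A -> A) (n : nat) : nat :=
  colength (ideal_of [set iter n phi x | x in m]).

End CommAlg.

Definition h_alg (RR : realType) (A : comNzRingType) (m : set A) (phi : A -> A) : RR :=
  limn (fun n : nat => ln ((lambda m phi n)%:R : RR) / n%:R).

(* Main.v *)
Require Import Defs.
From HB Require Import structures.
From mathcomp Require Import all_boot all_order all_algebra.
From mathcomp Require Import boolp classical_sets reals topology normedtype sequences exp.
From mathcomp Require Import ring zify.

Set Implicit Arguments. Unset Strict Implicit. Unset Printing Implicit Defensive.
Import Order.TTheory GRing.Theory Num.Theory.
Import numFieldNormedType.Exports.
Local Open Scope classical_set_scope.
Local Open Scope ring_scope.

(* Let mu_n be the least number of generators of phi^n_* R. The module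
   R/phi^n(m)R, taken through phi^n, has length mu_n and also
   [phi_* k : k]^n lambda(phi^n), so h_alg is the limit of (log mu_n)/n minus
   log [phi_* k : k]; this limit exists because mu is submultiplicative. Since
   phi^n_* R has rank deg(phi)^n, we get deg(phi)^n <= mu_n, which is (a).

   For (b) it suffices that mu_n <= e deg(phi)^n with e independent of n. Let x be
   a regular sequence of length d = dim R and e the length of R/(x). The sequence
   y = phi^n(x) generates an m-primary ideal, and depth sensitivity of the Koszul
   complex makes any such sequence of length d regular in its last element. Hence
   R/(y_1^k, ..., y_d^k) has length k^d times that of R/(y), so at least k^d mu_n
   through phi^n. But phi^n_* R is an extension of a torsion module by a free
   module of rank deg(phi)^n, so this length is at most
   k^d deg(phi)^n e + O(k^(d-1)). *)

(** * Length along a ring endomorphism *)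

Section Submodules.
Variable A : comNzRingType.
Implicit Types (psi : {rmorphism A -> A}) (f : A -> A) (U V I J P Q : set A).

(** Every module that occurs is A taken through an endomorphism psi, so submodules are subsets of A
    ([submod], convertible with [is_ideal] for [idfun]). The argument handles only the bounds
    [lenle] and [lenge], confronted by [lenge_le_lenle]. Upper bounds need only generators and
    elements killing them, so they pass easily along psi. Lower bounds need regularity, and since
    phi need not be flat, nothing directly transports the regularity of x to phi^n(x), nor to the
    mixed sequences in which only some entries are raised to the power k. What does pass is being a
    list of d elements contained in no prime but m; the Koszul complex turns this back into
    regularity. The powers k are there because at k = 1 the torsion part is uncontrolled: its size
    depends on n through a common denominator. For fixed n it is of lower order in k, so it
    disappears for large k, and this is what makes e independent of n. *)

Definition submod f U : Prop :=
  U 0 /\ (forall x y, U x -> U y -> U (x + y)) /\ (forall r x, U x -> U (f r * x)).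

Definition adj f U (x : A) : set A := [set z | exists a, U (z - f a * x)].

Fixpoint gen f U (zs : seq A) : set A :=
  if zs is z :: zs' then adj f (gen f U zs') z else U.

Lemma submod0 f U : submod f U -> U 0. Proof. by case. Qed.
Lemma submodD f U x y : submod f U -> U x -> U y -> U (x + y).
Proof. by case=> _ [h _]; exact: h. Qed.
Lemma submodM f U r x : submod f U -> U x -> U (f r * x).
Proof. by case=> _ [_ h]; exact: h. Qed.
Lemma submodN psi U x : submod psi U -> U x -> U (- x).
Proof. by move=> hU /(submodM (-1) hU); rewrite rmorphN1 mulN1r. Qed.
Lemma submodB psi U x y : submod psi U -> U x -> U y -> U (x - y).
Proof. by move=> hU hx hy; apply: (submodD hU) => //; exact: submodN hU hy. Qed.
Lemma submod_sum f U (T : finType) (F : T -> A) :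
  submod f U -> (forall t, U (F t)) -> U (\sum_t F t).
Proof.
move=> hU hF; elim/big_ind: _ => //; first exact: submod0 hU.
by move=> x y; exact: submodD hU.
Qed.

Lemma ideal_submod psi I : is_ideal I -> submod psi I.
Proof. by case=> h0 [hD hM]; split=> //; split=> // r x; apply: hM. Qed.
Lemma idealM I r x : is_ideal I -> I x -> I (x * r).
Proof. by move=> [_ [_ h]] hx; rewrite mulrC; exact: h. Qed.
Lemma idealB I x y : is_ideal I -> I x -> I y -> I (x - y).
Proof. exact: (@submodB idfun). Qed.
Lemma ideal1T I : is_ideal I -> I 1 -> I = setT.
Proof.
move=> hI h1; apply/seteqP; split=> // x _.
by rewrite -(mulr1 x); apply: (submodM x hI h1).
Qed.

Lemma adj_submod psi U x : submod psi U -> submod psi (adj psi U x).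
Proof.
move=> hU; split; first by exists 0; rewrite rmorph0 mul0r subr0; exact: submod0 hU.
split=> [y z [a ha] [b hb]|r y [a ha]].
  exists (a + b); rewrite rmorphD.
  by rewrite (_ : _ - _ = (y - psi a * x) + (z - psi b * x)); [exact: submodD hU ha hb|ring].
exists (r * a); rewrite rmorphM.
by rewrite (_ : _ - _ = psi r * (y - psi a * x)); [exact: submodM|ring].
Qed.

Lemma adj_sub psi U x : U `<=` adj psi U x.
Proof. by move=> y hy; exists 0; rewrite rmorph0 mul0r subr0. Qed.

Lemma adj_mul psi U x a : submod psi U -> adj psi U x (psi a * x).
Proof. by move=> hU; exists a; rewrite subrr; exact: submod0 hU. Qed.

Lemma adj_mem psi U x : submod psi U -> adj psi U x x.
Proof. by move=> hU; rewrite -[X in adj _ _ _ X]mul1r -(rmorph1 psi); apply: adj_mul. Qed.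

Lemma adj_min psi U V x : submod psi V -> U `<=` V -> V x -> adj psi U x `<=` V.
Proof.
move=> hV hUV hx y [a /hUV ha]; rewrite -(subrK (psi a * x) y).
by apply: (submodD hV ha); apply: submodM.
Qed.

Lemma adj_id psi U x : submod psi U -> U x -> adj psi U x = U.
Proof.
move=> hU hx; apply/seteqP; split; last exact: adj_sub.
exact: adj_min.
Qed.

Lemma adj_mono f U V x : U `<=` V -> adj f U x `<=` adj f V x.
Proof. by move=> h y [a /h ha]; exists a. Qed.

Lemma gen_submod psi U zs : submod psi U -> submod psi (gen psi U zs).
Proof. by move=> hU; elim: zs => //= z zs IH; apply: adj_submod. Qed.

Lemma gen_sub psi U zs : U `<=` gen psi U zs.
Proof. by elim: zs => //= z zs IH x /IH; apply: adj_sub. Qed.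

Lemma gen_mem psi U zs z : submod psi U -> z \in zs -> gen psi U zs z.
Proof.
move=> hU; elim: zs => //= y zs IH; rewrite inE => /orP[/eqP->|/IH h].
  by apply: adj_mem; apply: gen_submod.
exact: adj_sub.
Qed.

Lemma gen_min psi U V zs : submod psi V -> U `<=` V -> {in zs, forall z, V z} ->
  gen psi U zs `<=` V.
Proof.
move=> hV hUV; elim: zs => //= z zs IH h; apply: adj_min => //.
  by apply: IH => y hy; apply: h; rewrite inE hy orbT.
by apply: h; rewrite inE eqxx.
Qed.

Lemma gen_incl psi U V zs ys : submod psi V -> U `<=` V -> {subset zs <= ys} ->
  gen psi U zs `<=` gen psi V ys.
Proof.
move=> hV hUV h; apply: gen_min; first exact: gen_submod.
  by move=> x /hUV; apply: gen_sub.
by move=> z /h; apply: gen_mem.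
Qed.

Lemma gen_cat_cons psi U s z t : submod psi U ->
  gen psi U (s ++ z :: t) = gen psi U (z :: s ++ t).
Proof.
move=> hU; apply/seteqP; split; apply: gen_incl => // y.
  by rewrite !(inE, mem_cat) orbCA.
by rewrite !(inE, mem_cat) orbCA.
Qed.

End Submodules.

Section Length.
Variables (A : comNzRingType) (m : set A).
Hypothesis m_ideal : is_ideal m.
Hypothesis m_unit : forall a, ~ m a -> exists b, b * a = 1.
Hypothesis m_proper : ~ m 1.
Implicit Types (psi : {rmorphism A -> A}) (f : A -> A) (U V I J P Q : set A).

(* [lenle f U n] bounds the length of A / U from above, where A is a module
   through f: a series whose steps are cyclic and killed by m, hence of length
   at most one. [lenge f U n] bounds it from below by a strict chain. *)
Inductive lenle f : set A -> nat -> Prop :=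
| lenle_full U n : (forall x, U x) -> lenle f U n
| lenle_step U x n : (forall a, m a -> U (f a * x)) -> lenle f (adj f U x) n ->
    lenle f U n.+1.

Inductive lenge f : set A -> nat -> Prop :=
| lenge0 U : lenge f U 0
| lenge_step U V x n : submod f V -> U `<=` V -> V x -> ~ U x -> lenge f V n ->
    lenge f U n.+1.

Lemma lenle_mono f U V n : U `<=` V -> lenle f U n -> lenle f V n.
Proof.
move=> + h; elim: h V => {U n} [U n hU V hUV|U x n hx _ IH V hUV].
  by apply: lenle_full => x; apply: hUV.
by apply: (@lenle_step _ _ x) => [a /hx /hUV //|]; apply: IH; apply: adj_mono.
Qed.

Lemma lenle_le f U n p : (n <= p)%N -> lenle f U n -> lenle f U p.
Proof.
move=> + h; elim: h p => {U n} [U n hU p _|U x n hx _ IH [//|p] hp]; first exact: lenle_full.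
by apply: (lenle_step hx); apply: IH.
Qed.

Lemma lenge_mono f U V n : U `<=` V -> lenge f V n -> lenge f U n.
Proof.
move=> hUV h; case: h hUV => {V n} [V _|V W x n hW hVW hx hVx hn hUV]; first exact: lenge0.
by apply: (@lenge_step _ _ W x) => // [y /hUV /hVW //|/hUV].
Qed.

(** The chain loses a step only at its first member V containing x. Before that, x is adjoined to
    each member, and strictness survives: if t = v + psi(a)x with t in V and v in U, then psi(a)x is
    in V, so either a is in m and t was already in U, or a is a unit and x was in V. *)
Lemma lenge_adj psi U x n : submod psi U -> (forall a, m a -> U (psi a * x)) ->
  lenge psi U n -> lenge psi (adj psi U x) n.-1.
Proof.
move=> + + h; elim: h => {U n} [U _ _|U V t n hV hUV ht hUt hn IH hU hx]; first exact: lenge0.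
have [hVx|hVx] := pselect (V x).
  by apply: lenge_mono hn; apply: adj_min.
have := IH hV (fun a ha => hUV _ (hx a ha)).
case: n hn {IH} => [|n] hn IH; first exact: lenge0.
apply: (@lenge_step _ _ (adj psi V x) t) IH.
- exact: adj_submod.
- exact: adj_mono.
- exact: adj_sub.
- move=> [a ha].
  have hVa : V (psi a * x).
    rewrite (_ : _ * _ = t - (t - psi a * x)); last by ring.
    by apply: (submodB hV) => //; apply: hUV.
  have [ma|/m_unit [b hb]] := pselect (m a).
    by apply: hUt; rewrite -(subrK (psi a * x) t); apply: (submodD hU ha); apply: hx.
  apply: hVx; rewrite -(mul1r x) -(rmorph1 psi) -hb rmorphM -mulrA.
  exact: submodM.
Qed.

(** The Jordan-Hölder inequality: each simple step of the upper series costs a strict chain at most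
    one term. *)
Lemma lenge_le_lenle psi U N n : submod psi U -> lenge psi U N -> lenle psi U n -> (N <= n)%N.
Proof.
move=> + + h; elim: h N => {U n} [U n hU [//|N] _ h|U x n hx _ IH N hU hN].
  by inversion h as [|U' V y N' hV hUV hy hUy]; case: hUy; apply: hU.
have := IH N.-1 (adj_submod _ hU) (lenge_adj hU hx hN); lia.
Qed.

(** The map sending a to psi(a)u makes (U + psi(A)u)/U a quotient of A/I with its ordinary
    structure, so a series for A/I pushes forward. Lengths along psi are thereby bounded by ordinary
    ones. *)
Lemma lenle_cyclic psi U I u n p : submod psi U ->
  (forall a, I a -> U (psi a * u)) -> lenle idfun I n -> lenle psi (adj psi U u) p ->
  lenle psi U (n + p).
Proof.
move=> + + h; elim: h U => {I n} [I n hI U hU hIu hp|I x n hx _ IH U hU hIu hp].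
  apply: (@lenle_le _ _ p); first exact: leq_addl.
  by rewrite adj_id // in hp; rewrite -(mul1r u) -(rmorph1 psi); apply: hIu.
rewrite addSn; apply: (@lenle_step _ _ (psi x * u)).
  by move=> a ha; rewrite mulrA -rmorphM; apply: hIu; apply: hx.
apply: IH; first exact: adj_submod.
- move=> a [b hb]; exists b; rewrite mulrA -mulrBl -rmorphM -rmorphB; exact: hIu.
- by apply: lenle_mono hp; apply: adj_mono; apply: adj_sub.
Qed.

Lemma lenle_gen psi U I us n p : submod psi U ->
  {in us, forall u a, I a -> U (psi a * u)} -> lenle idfun I n ->
  lenle psi (gen psi U us) p -> lenle psi U (size us * n + p).
Proof.
move=> hU hus hn; elim: us hus p => [|u us IH] hus p //= hp.
rewrite mulSn [X in (X + _)%N]addnC -addnA; apply: IH.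
  by move=> v hv; apply: hus; rewrite inE hv orbT.
apply: (@lenle_cyclic _ _ I u) => //; first exact: gen_submod.
by move=> a ha; apply: gen_sub; apply: hus; rewrite ?inE ?eqxx.
Qed.

Lemma lenle_adj_mul I y z n p : is_ideal I -> lenle idfun (adj idfun I z) n ->
  lenle idfun (adj idfun I y) p -> lenle idfun (adj idfun I (y * z)) (n + p).
Proof.
move=> hI hn hp; apply: (@lenle_cyclic idfun _ (adj idfun I z) y) => //.
- exact: (@adj_submod _ idfun).
- move=> a [b hb]; exists b => /=; rewrite (_ : _ - _ = y * (a - b * z)); last by ring.
  exact: submodM hI hb.
- by apply: lenle_mono hp; apply: adj_mono; exact: (@adj_sub _ idfun).
Qed.

Lemma lenle_adj_exp I y n k : is_ideal I -> lenle idfun (adj idfun I y) n ->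
  lenle idfun (adj idfun I (y ^+ k)) (k * n).
Proof.
move=> hI hn; elim: k => [|k IH]; last by rewrite exprSr mulSn; apply: lenle_adj_mul.
rewrite mul0n; apply: lenle_full => x; exists x => /=.
by rewrite expr0 mulr1 subrr; exact: submod0 hI.
Qed.

(** The list [ts] holds the entries still at exponent one: the head z waits there while the others
    are raised, and is raised last. *)
Lemma lenle_gen_exp I zs ts n k : is_ideal I -> lenle idfun (gen idfun I (zs ++ ts)) n ->
  lenle idfun (gen idfun I ([seq z ^+ k | z <- zs] ++ ts)) (k ^ size zs * n).
Proof.
move=> hI; elim: zs ts => [|z zs IH] ts /=; first by rewrite mul1n.
rewrite expnS -mulnA => h; apply: lenle_adj_exp; first exact: (@gen_submod _ idfun).
rewrite -[adj _ _ _]/(gen idfun I (z :: _)) -(@gen_cat_cons _ idfun) //; apply: IH.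
by rewrite (@gen_cat_cons _ idfun).
Qed.

(* (I + yA)/(I + yzA) is isomorphic to A/(I + zA), as y is regular modulo I. *)
Lemma lenge_adj_mul psi I y z n p : is_ideal I -> (forall t, I (y * t) -> I t) ->
  lenge psi (adj idfun I z) n -> lenge psi (adj idfun I y) p ->
  lenge psi (adj idfun I (y * z)) (n + p).
Proof.
move=> hI hy hn hp.
have hJ := @adj_submod _ idfun I (y * z) hI.
suff H U : adj idfun I z `<=` U -> submod psi U -> lenge psi U n ->
    lenge psi [set w | exists2 j, U j & adj idfun I (y * z) (w - y * j)] (n + p).
  have hs := ideal_submod psi (@adj_submod _ idfun I z hI).
  apply: lenge_mono (H _ (@subset_refl _ _) hs hn) => w hw.
  by exists 0; [exact: submod0 hs|rewrite mulr0 subr0].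
move=> + + h; elim: h => {hn}[{}U hU _|{}U V x {}n hV hUV hx hUx hn IH hU hUs].
  rewrite add0n; apply: lenge_mono hp => w [j _ [b hb]] /=.
  by exists (j + b * z) => /=; rewrite (_ : _ - _ = w - y * j - b * (y * z)) //; ring.
have hzV : adj idfun I z `<=` V by move=> w /hU /hUV.
rewrite addSn; apply: (@lenge_step _ _ _ (y * x)) (IH hzV hV).
- split; first by exists 0; [exact: submod0 hV|rewrite mulr0 subr0; exact: submod0 hJ].
  split=> [v w [j hj hjv] [k hk hkw]|r v [j hj hjv]].
    exists (j + k); first exact: submodD hV hj hk.
    rewrite (_ : _ - _ = (v - y * j) + (w - y * k)); last by ring.
    exact: submodD hJ hjv hkw.
  exists (psi r * j); first exact: submodM hV hj.
  by rewrite (_ : _ - _ = psi r * (v - y * j)); [exact: (submodM _ hJ)|ring].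
- by move=> w [j /hUV hj hw]; exists j.
- by exists x => //; rewrite subrr; exact: submod0 hJ.
- move=> [j hj [b hb]]; apply: hUx; rewrite -(subrK j x); apply: (submodD hUs) => //.
  apply: hU; exists b => /=; apply: hy.
  by rewrite (_ : _ * _ = y * x - y * j - b * (y * z)) //; ring.
Qed.

Lemma lenge_adj_exp psi I y n k : is_ideal I -> (forall t, I (y * t) -> I t) ->
  lenge psi (adj idfun I y) n -> lenge psi (adj idfun I (y ^+ k)) (k * n).
Proof.
move=> hI hy hn; elim: k => [|k IH]; first by rewrite mul0n; apply: lenge0.
by rewrite exprS mulSn addnC; apply: lenge_adj_mul.
Qed.

(** Adjoining the v_i one at a time gives n strict steps inside V, since modulo U they are
    independent over the residue field. *)
Lemma lenge_indep psi U V n p (v : 'I_n -> A) : submod psi U -> submod psi V ->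
  U `<=` V -> (forall i, V (v i)) ->
  (forall c, U (\sum_i psi (c i) * v i) -> forall i, m (c i)) ->
  lenge psi V p -> lenge psi U (n + p).
Proof.
elim: n U v => [|n IH] U v hU hV hUV hv hind hp; first by apply: lenge_mono hp.
rewrite addSn; apply: (@lenge_step _ _ (adj psi U (v ord0)) (v ord0)).
- exact: adj_submod.
- exact: adj_sub.
- exact: adj_mem.
- move=> h0; apply: m_proper.
  suff /(_ ord0): forall i : 'I_n.+1, m (i == ord0)%:R by rewrite eqxx.
  apply: hind; rewrite big_ord_recl eqxx rmorph1 mul1r big1 ?addr0 // => i _.
  by rewrite (_ : _ == _ = false) // rmorph0 mul0r.
- apply: (IH _ (fun i => v (lift ord0 i))) => //; first exact: adj_submod.
    exact: adj_min.
  move=> c [a ha] i.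
  have := hind (fun j => if unlift ord0 j is Some j' then c j' else - a).
  rewrite big_ord_recl unlift_none rmorphN mulNr addrC.
  under eq_bigr do rewrite liftK.
  by move=> /(_ ha (lift ord0 i)); rewrite liftK.
Qed.

(** In a strict chain of maximal length the first step must be simple: if psi(a)x were outside U for
    some a in m, then U + psi(a)x could be inserted, because 1 - ba is a unit for every b
    (Nakayama). *)
Lemma lenle_of_max psi U n : submod psi U -> lenge psi U n ->
  (forall N, lenge psi U N -> (N <= n)%N) -> lenle psi U n.
Proof.
elim: n U => [|n IH] U hU hn hmax.
  apply: lenle_full => x; apply: contrapT => hx.
  suff /hmax : lenge psi U 1 by [].
  apply: (@lenge_step _ _ setT x) => //; exact: lenge0.
inversion hn as [|U' V x N hV hUV hx hUx hVn]; subst.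
have hxV : adj psi U x `<=` V by apply: adj_min.
apply: (@lenle_step _ _ x).
  move=> a ha; apply: contrapT => hax.
  suff /hmax : lenge psi U n.+2 by rewrite ltnn.
  apply: (@lenge_step _ _ (adj psi U (psi a * x)) (psi a * x)) => //.
  - exact: adj_submod.
  - exact: adj_sub.
  - exact: adj_mem.
  apply: (@lenge_step _ _ V x) => //; first by apply: adj_min => //; apply: submodM.
  move=> [b]; rewrite mulrA -rmorphM -{1}(mul1r x) -(rmorph1 psi) -mulrBl -rmorphB.
  move=> hb; have [|c hc] := m_unit (a := 1 - b * a).
    move=> h1; apply: m_proper; rewrite -(subrK (b * a) 1).
    by apply: (submodD m_ideal h1); apply: (submodM b m_ideal).
  apply: hUx; rewrite -(mul1r x) -(rmorph1 psi) -hc rmorphM -mulrA.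
  exact: submodM.
apply: IH; first exact: adj_submod.
  exact: lenge_mono hVn.
move=> N hN; suff /hmax : lenge psi U N.+1 by [].
apply: (@lenge_step _ _ (adj psi U x) x) => //.
- exact: adj_submod.
- exact: adj_sub.
- exact: adj_mem.
Qed.

End Length.

(** * The Koszul complex *)

Section Koszul.
Variable A : comNzRingType.
Implicit Types (J : set A) (zs xs : seq A).

(* The Koszul complex of a sequence, built as an iterated mapping cone: a pair
   (a, b) stands for a + e_z b, with b one degree lower than a. *)
Fixpoint koszul n : lmodType A :=
  if n is n'.+1 then (koszul n' * koszul n')%type else A^o.

(** The Koszul differential, from the rule that e_z b has boundary z b - e_z (boundary of b). *)
Fixpoint kbd zs : koszul (size zs) -> koszul (size zs) :=
  match zs return koszul (size zs) -> koszul (size zs) with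
  | [::] => fun=> 0
  | z :: zs' => fun u : koszul (size zs') * koszul (size zs') =>
      (kbd u.1 + z *: u.2, - kbd u.2)
  end.

Fixpoint kin J n : koszul n -> Prop :=
  match n return koszul n -> Prop with
  | 0 => fun u : A => J u
  | n'.+1 => fun u : koszul n' * koszul n' => kin J u.1 /\ kin J u.2
  end.

(* chains with no component in degree below i *)
Fixpoint kdeg i n : koszul n -> Prop :=
  match n return koszul n -> Prop with
  | 0 => fun u : A => (0 < i)%N -> u = 0
  | n'.+1 => fun u : koszul n' * koszul n' => kdeg i u.1 /\ kdeg i.-1 u.2
  end.

Definition klinear n (h : koszul n -> koszul n) :=
  forall a u v, h (a *: u + v) = a *: h u + h v.

Lemma klinear0 n (h : koszul n -> koszul n) : klinear h -> h 0 = 0.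
Proof. by move=> hh; have := hh (-1) 0 0; rewrite !scaleN1r oppr0 addr0 addNr. Qed.
Lemma klinearD n (h : koszul n -> koszul n) u v : klinear h -> h (u + v) = h u + h v.
Proof. by move=> hh; have := hh 1 u v; rewrite !scale1r. Qed.
Lemma klinearZ n (h : koszul n -> koszul n) a u : klinear h -> h (a *: u) = a *: h u.
Proof. by move=> hh; have := hh a u 0; rewrite !addr0 (klinear0 hh) addr0. Qed.
Lemma klinearN n (h : koszul n -> koszul n) u : klinear h -> h (- u) = - h u.
Proof. by move=> hh; rewrite -scaleN1r (klinearZ _ _ hh) scaleN1r. Qed.

Lemma kbd_linear zs : klinear (@kbd zs).
Proof.
elim: zs => [|z zs IH] a; first by move=> u v /=; rewrite scaler0 addr0.
move=> [u1 u2] [v1 v2] /=; rewrite !IH; congr pair => /=.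
  by rewrite scalerDr !scalerDr !scalerA [z * a]mulrC addrACA.
by rewrite opprD scalerN.
Qed.

Lemma kbdK zs u : kbd (@kbd zs u) = 0.
Proof.
elim: zs u => [|z zs IH] //= [a b] /=.
rewrite (klinearD _ _ (@kbd_linear zs)) (klinearZ _ _ (@kbd_linear zs)).
rewrite (klinearN _ (@kbd_linear zs)) !IH scalerN oppr0 add0r subrr.
by rewrite oppr0.
Qed.

Lemma kin0 J n : is_ideal J -> kin J (0 : koszul n).
Proof. by move=> hJ; elim: n => [|n IH] //=; exact: submod0 hJ. Qed.
Lemma kinD J n (u v : koszul n) : is_ideal J -> kin J u -> kin J v -> kin J (u + v).
Proof.
move=> hJ; elim: n u v => [|n IH] u v /=; first exact: submodD hJ.
by case: u v => [a b] [c d] /= [ha hb] [hc hd]; split; apply: IH.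
Qed.
Lemma kinZ J n a (u : koszul n) : is_ideal J -> kin J u -> kin J (a *: u).
Proof.
move=> hJ; elim: n u => [|n IH] u /=; first exact: submodM hJ.
by case: u => [c d] /= [hc hd]; split; apply: IH.
Qed.
Lemma kinN J n (u : koszul n) : is_ideal J -> kin J u -> kin J (- u).
Proof. by move=> hJ h; rewrite -scaleN1r; apply: kinZ. Qed.
Lemma kinB J n (u v : koszul n) : is_ideal J -> kin J u -> kin J v -> kin J (u - v).
Proof. by move=> hJ hu hv; apply: kinD => //; apply: kinN. Qed.
Lemma kin_mono J1 J2 n (u : koszul n) : J1 `<=` J2 -> kin J1 u -> kin J2 u.
Proof.
move=> h; elim: n u => [|n IH] u /=; first exact: h.
by case: u => [c d] /= [hc hd]; split; apply: IH.
Qed.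
Lemma kin_scale J n x (u : koszul n) : is_ideal J -> J x -> kin J (x *: u).
Proof.
move=> hJ hx; elim: n u => [|n IH] u /=; first exact: idealM.
by case: u => [c d] /=; split; apply: IH.
Qed.
Lemma kin_kbd J zs u : is_ideal J -> kin J u -> kin J (@kbd zs u).
Proof.
move=> hJ; elim: zs u => [|z zs IH] /=; first by move=> *; exact: submod0 hJ.
move=> [a b] /= [ha hb]; split; last by apply: kinN => //; apply: IH.
by apply: kinD => //; [exact: IH|exact: kinZ].
Qed.

Lemma kdeg00 n (u : koszul n) : kdeg 0 u.
Proof. by elim: n u => [|n IH] // [a b] /=; split; apply: IH. Qed.
Lemma kdeg0 i n : kdeg i (0 : koszul n).
Proof. by elim: n i => [|n IH] i //=; split; apply: IH. Qed.
Lemma kdegD i n (u v : koszul n) : kdeg i u -> kdeg i v -> kdeg i (u + v).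
Proof.
elim: n u v i => [|n IH] u v i /=; first by move=> hu hv hi; rewrite hu // hv // addr0.
by case: u v => [a b] [c d] /= [ha hb] [hc hd]; split; apply: IH.
Qed.
Lemma kdegZ i n a (u : koszul n) : kdeg i u -> kdeg i (a *: u).
Proof.
elim: n u i => [|n IH] u i /=; first by move=> hu hi; rewrite hu // scaler0.
by case: u => [c d] /= [hc hd]; split; apply: IH.
Qed.
Lemma kdegN i n (u : koszul n) : kdeg i u -> kdeg i (- u).
Proof. by move=> h; rewrite -scaleN1r; apply: kdegZ. Qed.
Lemma kdeg_kbd i zs u : kdeg i u -> kdeg i.-1 (@kbd zs u).
Proof.
elim: zs u i => [|z zs IH] u i /=; first by move=> _ _.
case: u => [a b] /= [ha hb]; split; last by apply: kdegN; apply: IH.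
by apply: kdegD; [exact: IH|exact: kdegZ].
Qed.
Lemma kdeg_big i n (u : koszul n) : (n < i)%N -> kdeg i u -> u = 0.
Proof.
elim: n u i => [|n IH] u i hi /=; first by apply.
case: u => a b /= [ha hb].
have -> : a = 0 := IH _ _ (ltnW hi) ha.
by have -> : b = 0 by apply: (IH _ i.-1) => //; case: i hi {ha hb}.
Qed.

Lemma kin_regular J n x (u : koszul n) : (forall y, J (x * y) -> J y) ->
  kin J (x *: u) -> kin J u.
Proof.
move=> hx; elim: n u => [|n IH] u /=; first exact: hx.
by case: u => a b /= [ha hb]; split; apply: IH.
Qed.

Lemma kin_adj J n x i (u : koszul n) : is_ideal J -> kin (adj idfun J x) u -> kdeg i u ->
  exists2 t, kdeg i t & kin J (u - x *: t).
Proof.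
move=> hJ; elim: n u i => [|n IH] u i /=.
  move=> [a ha] hi; case: i hi => [|i] hi.
    by exists a => //=; rewrite [_ *: _]mulrC.
  by exists 0 => //=; rewrite hi // scaler0 subr0; exact: submod0 hJ.
case: u => a b /= [ha hb] [ia ib].
have [ta ita hta] := IH _ _ ha ia; have [tb itb htb] := IH _ _ hb ib.
by exists (ta, tb).
Qed.

(** Writing x as the sum of the c_z z, the homotopy is left multiplication by the degree-one element
    that is the sum of the c_z e_z. *)
Lemma koszul_homotopy zs x : gen idfun [set 0] zs x ->
  exists h : koszul (size zs) -> koszul (size zs),
  [/\ klinear h, (forall i u, kdeg i u -> kdeg i.+1 (h u)),
      (forall J u, is_ideal J -> kin J u -> kin J (h u)) &
      (forall u, kbd (h u) + h (kbd u) = x *: u)].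
Proof.
elim: zs x => [|z zs IH] x /=.
  move=> ->; exists (fun=> 0); split=> //.
  - by move=> a u v; rewrite scaler0 addr0.
  - by move=> J u hJ _; exact: submod0 hJ.
  - by move=> u; rewrite scale0r addr0.
move=> [c /IH [h [hl hd hin hh]]].
exists (fun u : koszul (size zs) * koszul (size zs) => (h u.1, c *: u.1 - h u.2)); split.
- move=> a [u1 u2] [v1 v2] /=; rewrite !hl; congr pair => /=.
  by rewrite scalerBr opprD scalerDr !scalerA [c * a]mulrC addrACA.
- move=> i [a b] /= [ha hb]; split; first exact: hd.
  apply: kdegD; first exact: kdegZ.
  by apply: kdegN; case: i ha hb => [|i] _ hb; [exact: kdeg00|exact: hd].
- move=> J [a b] hJ /= [ha hb]; split; first exact: hin.
  by apply: kinB => //; [exact: kinZ|exact: hin].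
move=> [a b] /=; congr pair => /=.
  rewrite (klinearD _ _ hl) (klinearZ _ _ hl) scalerBr addrACA subrK hh /=.
  by rewrite scalerA -scalerDl [z * c]mulrC subrK.
rewrite (klinearD _ _ (@kbd_linear zs)) (klinearN _ (@kbd_linear zs)).
rewrite (klinearZ _ _ (@kbd_linear zs)) (klinearN _ hl) opprK opprB scalerDr.
by rewrite !addrA subrK addrAC hh scalerA -scalerDl subrK.
Qed.

Fixpoint regseq J xs : Prop :=
  if xs is x :: xs' then (forall y, J (x * y) -> J y) /\ regseq (adj idfun J x) xs'
  else True.

(* Depth sensitivity of the Koszul homology of A/J. Some power of x is homotopic
   to zero, and x can be cancelled: if x u bounds w modulo J, then w is a cycle
   modulo J + (x), hence a boundary there, and w = x t up to boundaries and J. *)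
Lemma koszul_exact zs xs J i u : is_ideal J -> regseq J xs ->
  {in xs, forall x, exists N, gen idfun [set 0] zs (x ^+ N)} ->
  (size zs < i + size xs)%N -> kdeg i u -> kin J (@kbd zs u) ->
  exists2 w, kdeg i.+1 w & kin J (u - kbd w).
Proof.
elim: xs J i u => [|x xs IH] J i u hJ /= hreg hrad hi hu hdu.
  (* With no regular element left, i exceeds the top degree of the complex, so u = 0. *)
  exists 0; first exact: kdeg0.
  rewrite (kdeg_big _ hu) ?(klinear0 (@kbd_linear zs)) ?subr0; first exact: kin0.
  by rewrite addn0 in hi.
case: hreg => hx hreg.
have hJx : is_ideal (adj idfun J x) := @adj_submod _ idfun J x hJ.
have hrad' : {in xs, forall x, exists N, gen idfun [set 0] zs (x ^+ N)}.
  by move=> y hy; apply: hrad; rewrite inE hy orbT.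
have cancel (v : koszul (size zs)) : kdeg i v ->
    (exists2 w, kdeg i.+1 w & kin J (x *: v - kbd w)) ->
    exists2 w, kdeg i.+1 w & kin J (v - kbd w).
  move=> hv [w hw hvw].
  have hdw : kin (adj idfun J x) (kbd w).
    rewrite -[kbd w](subKr (x *: v)); apply: kinB => //.
      by apply: kin_scale => //; exact: (@adj_mem _ idfun).
    by apply: kin_mono hvw; exact: (@adj_sub _ idfun).
  have [|s hs hws] := IH _ i.+1 w hJx hreg hrad' _ hw hdw; first by rewrite addSnnS.
  have hws' : kdeg i.+1 (w - kbd s).
    by apply: kdegD => //; apply: kdegN; exact: kdeg_kbd hs.
  have [t ht hwt] := kin_adj hJ hws hws'.
  exists t => //; apply: (kin_regular hx).
  rewrite scalerBr -(subrK (kbd w) (x *: v)) -addrA; apply: kinD => //.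
  have := kin_kbd hJ hwt; rewrite !(klinearD _ _ (@kbd_linear zs)).
  by rewrite !(klinearN _ (@kbd_linear zs)) (klinearZ _ _ (@kbd_linear zs)) kbdK oppr0 addr0.
have [N hN] := hrad x (mem_head _ _).
have [h [hl hdeg hin hh]] := koszul_homotopy hN.
have : exists2 w, kdeg i.+1 w & kin J (x ^+ N *: u - kbd w).
  exists (h u); first exact: hdeg.
  by rewrite -hh addrC addKr; apply: hin.
elim: N {hN hh} => [|N IHN]; first by rewrite scale1r.
rewrite exprS -scalerA => hN; apply: IHN; apply: cancel => //; exact: kdegZ.
Qed.

Fixpoint kunit n : koszul n :=
  match n return koszul n with 0 => (1 : A) | n'.+1 => (kunit n', 0) end.

Fixpoint kbot n : koszul n -> A :=
  match n return koszul n -> A with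
  | 0 => fun u : A => u
  | n'.+1 => fun u : koszul n' * koszul n' => kbot u.1
  end.

Lemma kbotZ n a (u : koszul n) : kbot (a *: u) = a * kbot u.
Proof. by elim: n u => [|n IH] // [c d] /=; exact: IH. Qed.
Lemma kbotD n (u v : koszul n) : kbot (u + v) = kbot u + kbot v.
Proof. by elim: n u v => [|n IH] // [a b] [c d] /=; exact: IH. Qed.
Lemma kbot_kunit n : kbot (kunit n) = 1.
Proof. by elim: n. Qed.

Lemma kbd_kunit zs : kbd (kunit (size zs)) = 0 :> koszul (size zs).
Proof.
elim: zs => [|z zs IH] //=.
by rewrite IH scaler0 addr0 (klinear0 (@kbd_linear zs)) oppr0.
Qed.

Lemma ideal0 : is_ideal [set (0 : A)].
Proof. by split=> //; split=> [x y -> ->|r x ->]; rewrite ?addr0 ?mulr0. Qed.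

Lemma kbot_kbd zs u : gen idfun [set 0] zs (kbot (@kbd zs u)).
Proof.
elim: zs u => [|z zs IH] //= [a b] /=.
by exists (kbot b) => /=; rewrite kbotD kbotZ [z * _]mulrC addrK.
Qed.

(** If z y lies in (zs), multiplication by it is null-homotopic on the complex of zs, so h(1) has
    boundary z y. Then h(1) - e_z y is a cycle of degree one for z :: zs. By depth sensitivity it is
    a boundary, and its e_z component exhibits y as a boundary of degree zero, that is, as an
    element of (zs). *)
Lemma koszul_regular z zs xs : regseq [set 0] xs -> size xs = (size zs).+1 ->
  {in xs, forall x, exists N, gen idfun [set 0] (z :: zs) (x ^+ N)} ->
  forall y, gen idfun [set 0] zs (z * y) -> gen idfun [set 0] zs y.
Proof.
move=> hreg hsz hrad y /koszul_homotopy [h [hl hd _ hh]].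
set n := size zs in h hl hd hh *.
pose u : koszul (size (z :: zs)) := (h (kunit n), - (y *: kunit n)).
have [|||[p q] [_ _] /= [_]] := @koszul_exact (z :: zs) xs [set 0] 1 u ideal0 hreg hrad.
- by rewrite hsz add1n.
- by split; [apply: hd; exact: kdeg00|exact: kdeg00].
- have := hh (kunit n); rewrite kbd_kunit (klinear0 hl) addr0 /= => ->.
  rewrite scalerN scalerA subrr (klinearN _ (@kbd_linear zs)).
  rewrite (klinearZ _ _ (@kbd_linear zs)) kbd_kunit scaler0 !oppr0.
  by split; exact: kin0 ideal0.
have kin_eq0 k (v : koszul k) : kin [set 0] v -> v = 0.
  elim: k v => [|k IH] //= [a b] /= [/IH ha /IH hb].
  by have -> : a = 0 := ha; have -> : b = 0 := hb.
move=> /kin_eq0; rewrite opprK addrC => /eqP; rewrite subr_eq0 => /eqP e.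
have := kbot_kbd q; rewrite e kbotZ kbot_kunit mulr1.
by [].
Qed.

End Koszul.

(** * Primes of a Noetherian ring *)

Section Noetherian.
Variable A : comNzRingType.
Hypothesis noethA : noetherian A.
Implicit Types (I J P Q S : set A).

Lemma ideal_of_ideal S : is_ideal (ideal_of S).
Proof.
split; first by exists 0%N, (fun=> 0), (fun=> 0); split=> [[]//|]; rewrite big_ord0.
split=> [x y [n [s [c [hs ->]]]] [p [t [d [ht ->]]]]|r x [n [s [c [hs ->]]]]].
  exists (n + p)%N, (fun i => match split i with inl j => s j | inr j => t j end),
    (fun i => match split i with inl j => c j | inr j => d j end).
  split=> [i|]; first by case: (split i).
  rewrite big_split_ord; congr (_ + _); apply: eq_bigr => i _.
    by rewrite (unsplitK (inl i)).
  by rewrite (unsplitK (inr i)).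
exists n, s, (fun i => r * c i); split=> //.
by rewrite mulr_sumr; apply: eq_bigr => i _; rewrite mulrA.
Qed.

Lemma ideal_of_mem S : S `<=` ideal_of S.
Proof.
by move=> x hx; exists 1%N, (fun=> x), (fun=> 1); split=> //; rewrite big_ord1 mul1r.
Qed.

Lemma ideal_of_min S I : is_ideal I -> S `<=` I -> ideal_of S `<=` I.
Proof.
move=> hI hS x [n [s [c [hs ->]]]]; apply: (@submod_sum _ idfun) => // i.
exact: (submodM (f := idfun) _ hI (hS _ (hs i))).
Qed.

(** Without it, choice yields a strictly increasing sequence of counterexamples; their union is
    finitely generated, hence equal to one of them. *)
Lemma noetherian_ind (Q : set A -> Prop) :
  (forall I, is_ideal I ->
    (forall J, is_ideal J -> I `<=` J -> J <> I -> Q J) -> Q I) ->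
  forall I, is_ideal I -> Q I.
Proof.
move=> hQ I0 hI0; apply: contrapT => nQ.
pose T := {I | is_ideal I /\ ~ Q I}.
have next (t : T) : {t' : T | sval t `<=` sval t' /\ sval t' <> sval t}.
  apply: cid; case: t => I [hI nI]; apply: contrapT => h.
  apply: (nI); apply: hQ => // J hJ hIJ hne; apply: contrapT => nJ.
  by apply: h; exists (exist _ J (conj hJ nJ)).
pose F n := iter n (fun t => sval (next t)) (exist _ I0 (conj hI0 nQ) : T).
have Fi n : is_ideal (sval (F n)) by case: (svalP (F n)).
have FS n : sval (F n) `<=` sval (F n.+1) by case: (svalP (next (F n))).
have Fm n p : (n <= p)%N -> sval (F n) `<=` sval (F p).
  move=> /subnK <-; elim: (p - n)%N => [|k IH] //.
  by apply: subset_trans IH _; rewrite addSn; exact: FS.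
pose U := [set x | exists n, sval (F n) x].
have hU : is_ideal U.
  split; first by exists 0%N; exact: submod0 (Fi 0%N).
  split=> [x y [n hx] [p hy]|r x [n hx]]; last by exists n; exact: (submodM r (Fi n) hx).
  exists (maxn n p); apply: (submodD (Fi _)).
    by apply: Fm hx; exact: leq_maxl.
  by apply: Fm hy; exact: leq_maxr.
have [k [s hs]] := noethA hU.
have /choice [g hg] i : exists n, sval (F n) (s i).
  by have : U (s i) by rewrite hs; apply: ideal_of_mem; exists i.
pose N := (\max_i g i)%N.
have hUN : U `<=` sval (F N).
  rewrite hs; apply: ideal_of_min => // _ [i _ <-].
  by apply: Fm (hg i); exact: leq_bigmax.
have [_ []] := svalP (next (F N)).
apply/seteqP; split; last exact: FS.
by move=> x hx; apply: hUN; exists N.+1.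
Qed.

Lemma not_prime_ideal I : is_ideal I -> I <> setT -> ~ prime_ideal I ->
  exists a b, [/\ I (a * b), ~ I a & ~ I b].
Proof.
move=> hI hT h; apply: contrapT => h'; apply: h; split=> //; split=> // x y hxy.
have [hx|hx] := pselect (I x); first by left.
by right; apply: contrapT => hy; apply: h'; exists x, y.
Qed.

Lemma adj_proper I a : is_ideal I -> ~ I a -> adj idfun I a <> I.
Proof. by move=> hI ha h; apply: ha; rewrite -h; exact: (@adj_mem _ idfun). Qed.

(** Noetherian induction takes the place of Zorn's lemma. If ab is in I, one of I + (a), I + (b)
    still avoids S, because elements of S in both would have their product in I and in S. *)
Lemma prime_avoiding I S : is_ideal I -> S 1 -> (forall x y, S x -> S y -> S (x * y)) ->
  (forall x, I x -> ~ S x) ->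
  exists P, [/\ prime_ideal P, I `<=` P & forall x, P x -> ~ S x].
Proof.
move=> hI S1 SM; move: I hI; apply: noetherian_ind => I hI IH hIS.
have [hp|/not_prime_ideal] := pselect (prime_ideal I); first by exists I; split.
have nT : I <> setT by move=> e; apply: (hIS 1) => //; rewrite e.
move=> /(_ hI nT) [a [b [hab ha hb]]].
have step c : ~ I c -> (forall x, adj idfun I c x -> ~ S x) ->
    exists P, [/\ prime_ideal P, I `<=` P & forall x, P x -> ~ S x].
  move=> hc hcS; have [P [hP hcP hPS]] := IH (adj idfun I c) (@adj_submod _ idfun I c hI)
    (@adj_sub _ idfun I c) (adj_proper hI hc) hcS.
  by exists P; split=> //; apply: subset_trans hcP; exact: (@adj_sub _ idfun).
have [h|h] := pselect (forall x, adj idfun I a x -> ~ S x); first exact: step ha h.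
apply: (step b hb) => y [d hy] Sy; apply: h => x [c hx] Sx.
apply: (hIS (x * y)); last exact: SM.
rewrite /= in hx hy.
rewrite (_ : x * y = y * (x - c * a) + (c * a) * (y - d * b) + c * d * (a * b)); last by ring.
apply: (submodD hI); first apply: (submodD hI); exact: (submodM (f := idfun)).
Qed.

Definition colon I a : set A := [set b | I (a * b)].

Lemma colon_ideal I a : is_ideal I -> is_ideal (colon I a).
Proof.
move=> hI; split; first by rewrite /colon /= mulr0; exact: submod0 hI.
split=> [x y hx hy|r x hx]; rewrite /colon /=; first by rewrite mulrDr; exact: submodD hI hx hy.
by rewrite mulrCA; exact: (submodM r hI hx).
Qed.

Lemma prime_idealP P : prime_ideal P -> is_ideal P. Proof. by case. Qed.
Lemma prime_ideal1 P : prime_ideal P -> ~ P 1.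
Proof. by move=> [hP [hT _]] /(ideal1T hP). Qed.
Lemma prime_idealX P x n : prime_ideal P -> P (x ^+ n) -> P x.
Proof.
move=> hP; elim: n => [|n IH]; first by rewrite expr0 => /(prime_ideal1 hP).
by rewrite exprS; case: hP => _ [_ h] /h[].
Qed.

Lemma prime_preim (psi : {rmorphism A -> A}) P : prime_ideal P -> prime_ideal (psi @^-1` P).
Proof.
move=> [hP [hT hM]]; split.
  split; first by rewrite /= rmorph0; exact: submod0 hP.
  split=> [x y|r x] /=; first by rewrite rmorphD; exact: submodD hP.
  by rewrite rmorphM; exact: (submodM (f := idfun)).
split; last by move=> x y; rewrite /= rmorphM; exact: hM.
move=> e; apply: hT; apply: ideal1T => //.
have : (psi @^-1` P) 1 by rewrite e.
by rewrite /= rmorph1.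
Qed.

Inductive prime_chain_from : set A -> nat -> Prop :=
| prime_chain_from0 P : prime_ideal P -> prime_chain_from P 0
| prime_chain_fromS P Q n : prime_ideal P -> P `<=` Q -> P <> Q ->
    prime_chain_from Q n -> prime_chain_from P n.+1.

Lemma prime_chain_from_chain P n : prime_chain_from P n -> prime_chain A n.
Proof.
move=> h; suff [F [_ hF]] : exists F : nat -> set A, F 0%N = P /\
    ((forall i, (i <= n)%N -> prime_ideal (F i)) /\
    (forall i, (i < n)%N -> F i `<=` F i.+1 /\ F i <> F i.+1)) by exists F.
elim: h => {P n} [P hP|P Q n hP hPQ hne _ [F [F0 [hF hS]]]].
  by exists (fun=> P).
exists (fun i => if i is i'.+1 then F i' else P); split=> //; split=> [[|i]|[|i]] //= hi.
- exact: hF.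
- by rewrite F0.
- exact: hS.
Qed.

(** Each regular element extends the chain downwards. Given P' containing J + (x), the
    multiplicative set of the s x^n with s outside P' misses J, as x is regular modulo J. A prime
    over J avoiding it lies inside P' and omits x, so it is strictly smaller. *)
Lemma regseq_prime_chain J Q xs j : is_ideal J -> regseq J xs -> J `<=` Q ->
  {in xs, forall x, Q x} -> prime_ideal Q -> prime_chain_from Q j ->
  exists2 P, J `<=` P & prime_chain_from P (size xs + j).
Proof.
elim: xs J => [|x xs IH] J hJ /= hreg hJQ hxs hQ hj; first by exists Q.
case: hreg => hx hreg; have hQi := prime_idealP hQ.
have [||P' hJP' hP'] := IH _ (@adj_submod _ idfun J x hJ) hreg _ _ hQ hj.
- by apply: (@adj_min _ idfun) => //; apply: hxs; exact: mem_head.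
- by move=> y hy; apply: hxs; rewrite inE hy orbT.
have pP' : prime_ideal P' by case: hP'.
pose S := [set y | exists s n, ~ P' s /\ y = s * x ^+ n].
have [|||P [pP hJP hPS]] := @prime_avoiding J S hJ.
- by exists 1, 0%N; rewrite mulr1; split=> //; exact: prime_ideal1.
- move=> _ _ [s [n [hs ->]]] [t [p [ht ->]]]; exists (s * t), (n + p)%N; split.
    by case: pP' => _ [_ h] /h[].
  by rewrite exprD; ring.
- move=> y hy [s [n [hs e]]]; apply: hs; apply: hJP'; apply: (@adj_sub _ idfun).
  rewrite e in hy => {e}; elim: n hy => [|n IHn]; first by rewrite mulr1.
  by rewrite exprS mulrCA => /hx.
have hPP' : P `<=` P'.
  move=> y hy; apply: contrapT => hn; apply: (hPS _ hy).
  by exists y, 0%N; rewrite mulr1.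
exists P => //; apply: (@prime_chain_fromS _ P') => // e.
apply: (hPS x); last by exists 1, 1%N; rewrite mul1r; split=> //; exact: prime_ideal1.
by rewrite e; apply: hJP'; exact: (@adj_mem _ idfun).
Qed.

(** * Local rings: primes over a regular sequence, and growth of lengths *)

Section Local.
Variable m : set A.
Hypothesis m_max : maximal_ideal m.
Hypothesis m_uniq : forall M, maximal_ideal M -> M = m.

Lemma proper_sub_max I : is_ideal I -> I <> setT -> I `<=` m.
Proof.
move: I; apply: noetherian_ind => I hI IH hT.
have [hM|hM] := pselect (maximal_ideal I); first by rewrite (m_uniq hM).
suff [J [hJ hIJ hne hJT]] : exists J, [/\ is_ideal J, I `<=` J, J <> I & J <> setT].
  exact: subset_trans hIJ (IH J hJ hIJ hne hJT).
apply: contrapT => h; apply: hM; split=> //; split=> // J hJ hIJ.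
have [e|hne] := pselect (J = I); first by left.
by right; apply: contrapT => hJT; apply: h; exists J.
Qed.

Lemma maximal_idealP : is_ideal m. Proof. by case: m_max. Qed.

Lemma maximal_ideal1 : ~ m 1.
Proof. by case: m_max => hm [hT _] /(ideal1T hm). Qed.

Lemma maximal_unit a : ~ m a -> exists b, b * a = 1.
Proof.
move=> ha; have hI := @adj_submod _ idfun _ a (ideal0 A).
have [e|h] := pselect (adj idfun [set 0] a = setT).
  have : adj idfun [set 0] a 1 by rewrite e.
  by move=> [b /eqP]; rewrite subr_eq0 => /eqP ->; exists b.
by case: ha; apply: (proper_sub_max hI h); exact: (@adj_mem _ idfun _ _ (ideal0 A)).
Qed.

Lemma maximal_prime : prime_ideal m.
Proof.
case: m_max => hm [hT _]; split=> //; split=> // x y hxy.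
have [hx|/maximal_unit [b hb]] := pselect (m x); first by left.
by right; rewrite -(mul1r y) -hb -mulrA; exact: (submodM b hm hxy).
Qed.

Lemma prime_sub_max P : prime_ideal P -> P `<=` m.
Proof. by move=> [hP [hT _]]; exact: proper_sub_max. Qed.

(** The regular sequence supplies d strict inclusions of primes ending at Q; a further one from Q to
    m would exceed the dimension. *)
Lemma regseq_prime_max d xs Q : krull_dim_is A d -> regseq [set 0] xs -> size xs = d ->
  prime_ideal Q -> {in xs, forall x, Q x} -> Q = m.
Proof.
move=> [_ hd] hreg hsz hQ hxs; apply: contrapT => hne.
have hc : prime_chain_from Q 1.
  apply: (@prime_chain_fromS _ m) => //; first exact: prime_sub_max.
  by apply: prime_chain_from0; exact: maximal_prime.
have h0 : [set 0] `<=` Q by move=> _ ->; exact: submod0 (prime_idealP hQ).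
have [P _ /prime_chain_from_chain/hd] := regseq_prime_chain (ideal0 A) hreg h0 hxs hQ hc.
by rewrite hsz addn1 ltnn.
Qed.

(* The length of A/(J, z^k : z in zs) is O(k^(d-1)), stated without d - 1. *)
Definition growth d J (zs : seq A) := exists C, forall k, (0 < k)%N ->
  exists2 h, lenle m idfun (gen idfun J [seq z ^+ k | z <- zs]) h & (k * h <= C * k ^ d)%N.

(** Dévissage: if ab is in J with a, b outside, then A/J is an extension of A/(J + (a)) by A/(J :
    a), and both ideals are larger than J, the second because it contains b. The bounds add up. *)
Lemma growth_of_primes d J zs : is_ideal J ->
  (forall Q, prime_ideal Q -> J `<=` Q -> growth d Q zs) -> growth d J zs.
Proof.
move: J; apply: noetherian_ind => J hJ IH hQ.
have [hp|/(not_prime_ideal hJ)] := pselect (prime_ideal J); first exact: hQ.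
have [e _|hT /(_ hT) [a [b [hab ha hb]]]] := pselect (J = setT).
  exists 0%N => k hk; exists 0%N; last by rewrite muln0.
  by apply: lenle_full => x; apply: gen_sub; rewrite e.
have [|C1 h1] := IH _ (@adj_submod _ idfun J a hJ) (@adj_sub _ idfun J a) (adj_proper hJ ha).
  by move=> Q pQ hQa; apply: hQ => //; apply: subset_trans hQa; exact: (@adj_sub _ idfun).
have hJc : J `<=` colon J a by move=> x hx; exact: (submodM a hJ hx).
have [||C2 h2] := IH _ (colon_ideal a hJ) hJc.
- by move=> e; apply: hb; rewrite -e.
- by move=> Q pQ hQc; apply: hQ => //; exact: subset_trans hQc.
exists (C2 + C1)%N => k hk.
have [n1 l1 b1] := h1 k hk; have [n2 l2 b2] := h2 k hk.
exists (n2 + n1)%N; last by rewrite mulnDr mulnDl leq_add.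
set zk := map _ _ in l1 l2 *.
have hU : is_ideal (gen idfun J zk) := @gen_submod _ idfun J zk hJ.
apply: (@lenle_cyclic _ _ idfun _ (gen idfun (colon J a) zk) a) => //.
  move=> c hc /=; rewrite mulrC; move: c hc.
  apply: (@gen_min _ idfun (colon J a) (colon (gen idfun J zk) a) zk).
  - exact: colon_ideal.
  - by move=> x hx; apply: gen_sub.
  - by move=> z hz; apply: (submodM a hU); exact: (@gen_mem _ idfun).
apply: lenle_mono l1; apply: (@gen_min _ idfun).
- exact: (@adj_submod _ idfun).
- by apply: adj_mono; exact: gen_sub.
- by move=> z hz; apply: (@adj_sub _ idfun); exact: (@gen_mem _ idfun).
Qed.

Lemma lenle_max : lenle m idfun m 1.
Proof.
apply: (@lenle_step _ _ _ _ 1) => [a /=|]; first by rewrite mulr1.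
apply: lenle_full => x; exists x => /=; rewrite mulr1 subrr.
exact: submod0 maximal_idealP.
Qed.

(** With no [zs] and k = 1, [growth] is mere finiteness of length, so the reduction to primes leaves
    only A/m. *)
Lemma lenle_finite J : is_ideal J -> (forall Q, prime_ideal Q -> J `<=` Q -> Q = m) ->
  exists n, lenle m idfun J n.
Proof.
move=> hJ hQ; have [|C /(_ 1%N isT) [n hn _]] := @growth_of_primes 1 J [::] hJ; last by exists n.
move=> Q pQ /(hQ _ pQ) -> /=; exists 1%N => k _; exists 1%N; first exact: lenle_max.
by rewrite expn1 mulnC.
Qed.

(* Some x in zs lies outside P, the length for x^k is at most k times the one for
   x, and the primes containing P + (x) have smaller coheight. *)
Lemma growth_prime d P (zs : seq A) :
  (forall Q, prime_ideal Q -> {in zs, forall z, Q z} -> Q = m) ->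
  prime_ideal P -> (forall n, prime_chain_from P n -> (n < d)%N) -> growth d P zs.
Proof.
move=> hQ; elim: d P => [|d IH] P pP hn.
  by have := hn 0%N (prime_chain_from0 pP).
have hP := prime_idealP pP.
have [e|hne] := pselect (P = m).
  exists 1%N => k hk; exists 1%N; last by rewrite muln1 mul1n expnS leq_pmulr // expn_gt0 hk.
  by apply: lenle_mono lenle_max; rewrite -e; exact: gen_sub.
have [x [hx hxP]] : exists x, x \in zs /\ ~ P x.
  apply: contrapT => h; apply: hne; apply: hQ => // z hz.
  by apply: contrapT => hz'; apply: h; exists z.
have [|C hC] := @growth_of_primes d _ zs (@adj_submod _ idfun P x hP).
  move=> Q pQ hPQ; apply: IH => // n hQn.
  have hPQ' : P `<=` Q by apply: subset_trans hPQ; exact: (@adj_sub _ idfun).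
  suff /hn : prime_chain_from P n.+1 by [].
  apply: (@prime_chain_fromS _ Q) => // e; apply: hxP; rewrite e.
  by apply: hPQ; exact: (@adj_mem _ idfun).
exists C => k hk; have [n ln bn] := hC k hk.
exists (k * n)%N; last by rewrite expnS mulnCA leq_mul.
(* The entry x is brought to the front and only its exponent is lowered from k to 1. The bound for P
   + (x) then applies, since x^k is redundant in that ideal. *)
have [s [t e]] : exists s t, zs = s ++ x :: t by case/splitPr: hx => s t; exists s, t.
set st := [seq z ^+ k | z <- s] ++ [seq z ^+ k | z <- t].
have -> : gen idfun P [seq z ^+ k | z <- zs] = adj idfun (gen idfun P st) (x ^+ k).
  by rewrite e map_cat /= (@gen_cat_cons _ idfun).
have hst : is_ideal (gen idfun P st) := @gen_submod _ idfun P st hP.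
apply: lenle_adj_exp => //; apply: lenle_mono ln.
have hxst := @adj_submod _ idfun _ x hst.
apply: (@gen_min _ idfun) => //; first by apply: adj_mono; exact: gen_sub.
move=> z; rewrite e map_cat mem_cat /= inE orbCA -mem_cat => /orP[/eqP->|hz].
  by rewrite -(prednK hk) exprSr; exact: (@adj_mul _ idfun).
by apply: (@adj_sub _ idfun); exact: (@gen_mem _ idfun).
Qed.

End Local.
End Noetherian.

(** * Independent and generating families *)

Section Families.
Variable A : comNzRingType.
Implicit Types (P I U : set A) (phi psi : {rmorphism A -> A}).

(* For P = 0 these are independence and spanning up to torsion in the module
   psi_* A; for P the maximal ideal they are independence and spanning in the
   residue field. *)
Definition indep P (f : A -> A) (T : finType) (v : T -> A) : Prop :=
  forall c : T -> A, P (\sum_t f (c t) * v t) -> forall t, P (c t).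
Definition torsion_span P (f : A -> A) (T : finType) (v : T -> A) : Prop :=
  forall z, exists a (c : T -> A), ~ P a /\ P (f a * z - \sum_t f (c t) * v t).
Definition generates (f : A -> A) (T : finType) (v : T -> A) : Prop :=
  forall x, exists c : T -> A, x = \sum_t f (c t) * v t.

Definition has_basis P f n := exists2 v : 'I_n -> A, indep P f v & torsion_span P f v.
Definition has_gens f n := exists v : 'I_n -> A, generates f v.

Lemma sum_enum_rank (T : finType) (F : 'I_#|T| -> A) :
  \sum_i F i = \sum_t F (enum_rank t).
Proof. by rewrite (reindex _ (onW_bij _ (enum_rank_bij T))). Qed.

Lemma has_basis_card P f (T : finType) (v : T -> A) :
  indep P f v -> torsion_span P f v -> has_basis P f #|T|.
Proof.
move=> hi hs; exists (fun i => v (enum_val i)).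
  move=> c; rewrite sum_enum_rank => h i.
  rewrite -(enum_valK i); apply: (hi (fun t => c (enum_rank t))).
  by under eq_bigr do rewrite -[X in v X]enum_rankK.
move=> z; have [a [c [ha hc]]] := hs z; exists a, (fun i => c (enum_val i)); split=> //.
by rewrite sum_enum_rank; under eq_bigr do rewrite enum_rankK.
Qed.

Lemma has_gens_card f (T : finType) (v : T -> A) : generates f v -> has_gens f #|T|.
Proof.
move=> h; exists (fun i => v (enum_val i)) => x; have [c ->] := h x.
exists (fun i => c (enum_val i)).
by rewrite sum_enum_rank; under [RHS]eq_bigr do rewrite enum_rankK.
Qed.

(** Gaussian elimination without fractions in the domain A/P: the rows other than the pivot row are
    multiplied by the pivot p, and the coefficient of the pivot row is recovered at the end. *)
Lemma prime_dependence P r s (B : 'I_r -> 'I_s -> A) : prime_ideal P -> (s < r)%N ->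
  exists c : 'I_r -> A, (exists i, ~ P (c i)) /\ forall j, P (\sum_i c i * B i j).
Proof.
move=> pP; have hP := prime_idealP pP.
have pM : forall x y, P (x * y) -> P x \/ P y by case: pP => _ [].
elim: s r B => [|s IH] [//|r] B hr.
  exists (fun=> 1); split; last by case.
  by exists ord0; exact: prime_ideal1.
have [h0|] := pselect (forall i, P (B i ord0)).
  have [|c [hc hcB]] := IH _ (fun i j => B i (lift ord0 j)); first exact: ltnW hr.
  exists c; split=> // j; case: (unliftP ord0 j) => [j' ->|->]; first exact: hcB.
  by apply: (@submod_sum _ idfun) => // i; exact: (submodM (c i) hP).
move=> /existsNP [i0 hp]; set p := B i0 ord0 in hp.
have [|c [[i hi] hcB]] := IH r (fun i j =>
    p * B (lift i0 i) (lift ord0 j) - B (lift i0 i) ord0 * B i0 (lift ord0 j)) => //.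
exists (fun k => if unlift i0 k is Some k' then p * c k' else
   - \sum_k' c k' * B (lift i0 k') ord0); split.
  by exists (lift i0 i); rewrite liftK => /pM[].
move=> j; rewrite (bigD1_ord i0) //= unlift_none; under [X in _ + X]eq_bigr do rewrite liftK.
case: (unliftP ord0 j) => [j' ->|->].
  have := hcB j'; rewrite mulNr mulr_suml -sumrN -big_split /=.
  congr P; apply: eq_bigr => k _; ring.
rewrite mulNr mulr_suml -sumrN -big_split /= big1; first exact: submod0 hP.
by move=> k _; rewrite /p; ring.
Qed.

Lemma sum_gens_dependence P psi r s (w : 'I_s -> A) (v : 'I_r -> A) :
  prime_ideal P -> generates psi w -> (s < r)%N ->
  exists c : 'I_r -> A, (exists i, ~ P (psi (c i))) /\ P (\sum_i psi (c i) * v i).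
Proof.
move=> pP hw hr; have /choice [B hB] i := hw (v i).
have [c [hc hcB]] := prime_dependence B (prime_preim psi pP) hr.
exists c; split=> //; under eq_bigr do rewrite hB mulr_sumr.
rewrite exchange_big /=; apply: (@submod_sum _ idfun) => [|j]; first by case: pP.
under eq_bigr do rewrite mulrA -rmorphM.
rewrite -mulr_suml -rmorph_sum; apply: idealM; first by case: pP.
exact: hcB.
Qed.

Lemma indep_le_gens P psi n g (v : 'I_n -> A) : prime_ideal P ->
  (forall x, P x -> P (psi x)) -> has_gens psi g -> indep P psi v -> (n <= g)%N.
Proof.
move=> pP hpsi [w hw] hv; rewrite leqNgt; apply/negP => hr.
have [c [[i hi] hc]] := sum_gens_dependence v pP hw hr.
by apply: hi; apply: hpsi; exact: hv.
Qed.

(* The integrality argument behind incomparability of primes. *)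
Lemma image_multiple P psi g c : prime_ideal P -> has_gens psi g -> ~ P c ->
  exists a b, ~ P (psi a) /\ P (psi a - c * b).
Proof.
move=> pP [w hw] hc; have hP := prime_idealP pP.
have [k [hk hs]] := sum_gens_dependence (fun i : 'I_g.+1 => c ^+ i) pP hw (ltnSn g).
elim: g.+1 k hk hs {w hw} => [|n IH] k [i hi]; first by case: i hi.
rewrite big_ord_recl expr0 mulr1.
under eq_bigr do rewrite exprS mulrCA.
rewrite -mulr_sumr => hs.
(* A constant coefficient in P lets a factor c be cancelled, which shortens the relation; otherwise
   that coefficient is the desired multiple of c modulo P. *)
have [h0|h0] := pselect (P (psi (k ord0))).
  apply: (IH (fun j => k (lift ord0 j))).
    by case: (unliftP ord0 i) hi => [j ->|->] // hj; exists j.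
  suff : P (c * \sum_(j < n) psi (k (lift ord0 j)) * c ^+ j) by case: pP => _ [_ h] /h[].
  by rewrite -[X in P X](addKr (psi (k ord0))) addrC; exact: idealB.
exists (k ord0), (- \sum_(j < n) psi (k (lift ord0 j)) * c ^+ j); split=> //.
by rewrite mulrN opprK.
Qed.

Lemma max_indep_basis P psi n : is_ideal P ->
  is_max (fun k => exists v : 'I_k -> A, indep P psi v) n -> (forall x, P x -> P (psi x)) ->
  has_basis P psi n.
Proof.
move=> hP [[v hv] hmax] hpsi; exists v => // z.
have : ~ indep P psi (fun i : 'I_n.+1 => if unlift ord0 i is Some j then v j else z).
  by move=> h; have := hmax n.+1 (ex_intro _ _ h); rewrite ltnn.
move=> /existsNP [c /not_implyP [hc /existsNP [i hi]]].
rewrite big_ord_recl unlift_none in hc.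
move: hc; under eq_bigr do rewrite liftK.
move=> hc.
exists (c ord0), (fun j => - c (lift ord0 j)); split.
  move=> h0; case: (unliftP ord0 i) hi => [j ->|->] // hj; apply: hj.
  move: j; apply: (hv (fun j => c (lift ord0 j))).
  rewrite -[X in P X](addKr (psi (c ord0) * z)) addrC; apply: idealB => //.
  by apply: idealM => //; exact: hpsi.
by under eq_bigr do rewrite rmorphN mulNr; rewrite sumrN opprK.
Qed.

(** [natmax] silently returns 0 when there is no maximum; boundedness excludes that default. *)
Lemma is_max_natmax (Q : nat -> Prop) b : Q 0%N -> (forall n, Q n -> (n <= b)%N) ->
  is_max Q (natmax Q).
Proof.
move=> Q0 hb; rewrite /natmax; case: pselect => [h|[]]; first by case: (cid h).
have ex : exists n, `[< Q n >] by exists 0%N; apply/asboolP.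
have bd n : `[< Q n >] -> (n <= b)%N by move=> /asboolP /hb.
case: (ex_maxnP ex bd) => n /asboolP hn hmax; exists n; split=> // k hk.
by apply: hmax; apply/asboolP.
Qed.

Lemma natmax_eq (Q : nat -> Prop) n : is_max Q n -> natmax Q = n.
Proof.
move=> h; rewrite /natmax; case: pselect => [h'|[]]; last by exists n.
case: (cid h') => k [hk hk'] /=; case: h => hn hn'.
by apply/eqP; rewrite eqn_leq hk' ?hn'.
Qed.

(** For P = 0 and P = m the number is, by conversion, [deg] and [res_deg], so both are treated at
    once. *)
Lemma basis_natmax P psi g : prime_ideal P -> (forall x, P x -> P (psi x)) -> has_gens psi g ->
  has_basis P psi (natmax (fun k => exists v : 'I_k -> A, indep P psi v)).
Proof.
move=> pP hpsi hg; apply: max_indep_basis => //; first by case: pP.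
apply: (@is_max_natmax _ g) => [|n [v hv]]; last exact: indep_le_gens hg hv.
by exists (fun=> 0) => c _ [].
Qed.

Lemma has_basis_id P : prime_ideal P -> has_basis P (idfun : A -> A) 1.
Proof.
move=> pP; exists (fun=> 1) => [c /=|z].
  by rewrite big_ord1 mulr1 => h t; rewrite (ord1 t).
exists 1, (fun=> z); split; first exact: prime_ideal1.
by rewrite big_ord1 /= mul1r mulr1 subrr; case: pP => -[].
Qed.

(** Multiplicativity of degrees in a tower, with the products psi(r_j) s_i as basis. The work lies
    in the denominators, which must come from the image of the composite. *)
Lemma has_basis_comp P psi phi a b g : prime_ideal P -> (forall x, P x -> P (psi x)) ->
  (forall x, P x -> P (phi x)) -> has_gens phi g ->
  has_basis P psi a -> has_basis P phi b -> has_basis P (psi \o phi) (a * b).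
Proof.
move=> pP hpsi hphi hg [s hs hs'] [r hr hr']; have hP := prime_idealP pP.
have -> : (a * b = #|{: 'I_a * 'I_b}|)%N by rewrite card_prod !card_ord.
apply: (@has_basis_card _ _ _ (fun ij => psi (r ij.2) * s ij.1)).
  move=> c; rewrite (_ : \sum_t _ = \sum_i \sum_j psi (phi (c (i, j))) * (psi (r j) * s i)); last first.
    by rewrite pair_bigA; apply: eq_bigr => -[].
 
  under eq_bigr do under eq_bigr do rewrite mulrA -rmorphM.
  under eq_bigr do rewrite -mulr_suml -rmorph_sum.
  move=> /hs h [i j]; exact: (hr (fun j => c (i, j)) (h i)).
move=> z; have [d [c [hd hc]]] := hs' z.
(* The denominator d need not lie in the image of phi, so it is replaced by its multiple d w,
   congruent to phi(u) modulo P. *)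
have [u [w [hu huw]]] := image_multiple pP hg hd.
have /choice [e /choice [f hef]] i := hr' (w * c i).
exists (u * \prod_i e i), (fun ij => (\prod_(k | k != ij.1) e k) * f ij.1 ij.2); split.
  have hMn x y : ~ P x -> ~ P y -> ~ P (x * y) by case: pP => _ [_ h] ? ? /h[].
  apply: (hMn); first by move=> /hphi.
  elim/big_ind: _ => [||k _]; [exact: prime_ideal1|exact: hMn|].
  by case: (hef k).
rewrite -(pair_bigA _ (fun i j => psi (phi ((\prod_(k | k != i) e k) * f i j)) * (psi (r j) * s i))) /=.
under [X in _ - X]eq_bigr do under eq_bigr do rewrite mulrA -rmorphM.
under [X in _ - X]eq_bigr do rewrite -mulr_suml -rmorph_sum.
set p := \prod_i e i.
(* Three errors, each in P: exchanging phi(u) for d w, expanding z in the s_i, and expanding each w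
   c_i in the r_j after clearing its denominator e_i. *)
rewrite (_ : _ - _ = psi (phi p) * psi (phi u - d * w) * z +
   psi (phi p) * psi w * (psi d * z - \sum_i psi (c i) * s i) +
   \sum_i psi (phi p * (w * c i) - \sum_j phi ((\prod_(k | k != i) e k) * f i j) * r j) * s i); last first.
  under [X in _ = _ + X]eq_bigr do rewrite rmorphB mulrBl.
  rewrite sumrB !(rmorphM, rmorphB).
  under [X in _ = _ + (X - _)]eq_bigr do rewrite !rmorphM -!mulrA [psi w * _]mulrA.
  rewrite -mulr_sumr.
  under [X in _ = _ + (_ * X - _)]eq_bigr do rewrite -mulrA.
  by rewrite -mulr_sumr; ring.
apply: (submodD hP); first apply: (submodD hP).
- by rewrite -mulrA mulrCA; apply: idealM => //; exact: hpsi.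
- exact: (submodM (f := idfun) _ hP).
apply: (@submod_sum _ idfun) => // i; apply: idealM => //; apply: hpsi.
rewrite /p (bigD1 i) //=.
under [X in _ - X]eq_bigr do rewrite rmorphM -mulrA.
rewrite -mulr_sumr rmorphM.
rewrite (_ : _ - _ = phi (\prod_(k | k != i) e k) * (phi (e i) * (w * c i) - \sum_j phi (f i j) * r j)).
  by apply: (submodM (f := idfun) _ hP); case: (hef i).
by ring.
Qed.

Lemma has_gens_id : has_gens (idfun : A -> A) 1.
Proof. by exists (fun=> 1) => x; exists (fun=> x); rewrite big_ord1 mulr1. Qed.

Lemma has_gens_comp psi phi a b : has_gens psi a -> has_gens phi b ->
  has_gens (psi \o phi) (a * b).
Proof.
move=> [s hs] [r hr].
have -> : (a * b = #|{: 'I_a * 'I_b}|)%N by rewrite card_prod !card_ord.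
apply: (@has_gens_card _ _ (fun ij => psi (r ij.2) * s ij.1)) => x.
have [c ->] := hs x; have /choice [d hd] i := hr (c i).
exists (fun ij => d ij.1 ij.2).
rewrite -(pair_bigA _ (fun i j => psi (phi (d i j)) * (psi (r j) * s i))) /=.
apply: eq_bigr => i _; rewrite hd rmorph_sum mulr_suml.
by apply: eq_bigr => j _; rewrite rmorphM mulrA.
Qed.

Fixpoint iterm phi n : {rmorphism A -> A} :=
  if n is n'.+1 then (iterm phi n' \o phi : {rmorphism A -> A}) else (idfun : {rmorphism A -> A}).

Lemma itermE phi n x : iterm phi n x = iter n phi x.
Proof. by elim: n x => [|n IH] x //; rewrite iterSr -IH. Qed.

Lemma iterm_closed phi P n : (forall x, P x -> P (phi x)) -> forall x, P x -> P (iterm phi n x).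
Proof. by move=> h; elim: n => [|n IH] // x hx; apply: IH; exact: h. Qed.

Lemma has_gens_iterm phi g n : has_gens phi g -> has_gens (iterm phi n) (g ^ n).
Proof.
move=> h; elim: n => [|n IH]; first exact: has_gens_id.
by rewrite expnSr; exact: has_gens_comp.
Qed.

Lemma has_basis_iterm P phi g d n : prime_ideal P -> (forall x, P x -> P (phi x)) ->
  has_gens phi g -> has_basis P phi d -> has_basis P (iterm phi n) (d ^ n).
Proof.
move=> pP hphi hg hd; elim: n => [|n IH]; first exact: has_basis_id.
by rewrite expnSr; apply: has_basis_comp hg IH hd => //; exact: iterm_closed.
Qed.

End Families.

(** * Minimal generators, and lengths under restriction along psi *)

Section MinimalGenerators.
Variables (A : comNzRingType) (m : set A).
Hypothesis m_ideal : is_ideal m.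
Hypothesis m_unit : forall a, ~ m a -> exists b, b * a = 1.
Hypothesis m_proper : ~ m 1.
Implicit Types (I U : set A) (phi psi : {rmorphism A -> A}).

Definition ext psi : set A := ideal_of [set psi x | x in m].

Lemma ext_ideal psi : is_ideal (ext psi).
Proof. exact: ideal_of_ideal. Qed.

Lemma ext_mem psi a x : m a -> ext psi (psi a * x).
Proof.
by move=> ha; apply: idealM; [exact: ext_ideal|apply: ideal_of_mem; exists a].
Qed.

(** The ideal psi(m)A is m times the module A through psi, so generators of the module suffice with
    coefficients in m. *)
Lemma ext_gens psi n (v : 'I_n -> A) z : generates psi v -> ext psi z ->
  exists2 a : 'I_n -> A, (forall i, m (a i)) & z = \sum_i psi (a i) * v i.
Proof.
move=> hv; apply: (@ideal_of_min _ _ [set z | exists2 a : 'I_n -> A, (forall i, m (a i)) &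
  z = \sum_i psi (a i) * v i]) => [|_ [x hx <-]].
  split; first exists (fun=> 0).
  - by move=> _; exact: submod0 m_ideal.
  - by rewrite big1 // => i _; rewrite rmorph0 mul0r.
  split=> [_ _ [a ha ->] [b hb ->]|r _ [a ha ->]].
    exists (fun i => a i + b i); first by move=> i; exact: submodD m_ideal _ _.
    by rewrite -big_split; apply: eq_bigr => i _; rewrite rmorphD mulrDl.
  have /choice [d hd] i := hv (r * v i).
  exists (fun j => \sum_i a i * d i j).
    by move=> j; apply: (@submod_sum _ idfun) => // i; exact: idealM.
  under [RHS]eq_bigr do rewrite rmorph_sum mulr_suml.
  rewrite exchange_big mulr_sumr; apply: eq_bigr => i _ /=.
  rewrite mulrCA hd mulr_sumr; apply: eq_bigr => j _.
  by rewrite rmorphM mulrA.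
have [c hc] := hv 1; exists (fun i => x * c i); first by move=> i; exact: idealM.
rewrite -[LHS]mulr1 hc mulr_sumr; apply: eq_bigr => i _.
by rewrite rmorphM mulrA.
Qed.

(** Nakayama: subtracting an expression with coefficients in m from one with c_i outside m leaves a
    unit in front of v_i, which makes v_i redundant. *)
Lemma min_gens_indep psi n (v : 'I_n -> A) c : generates psi v ->
  (forall k, has_gens psi k -> (n <= k)%N) -> ext psi (\sum_i psi (c i) * v i) ->
  forall i, m (c i).
Proof.
case: n v c => [|n] v c hv hmin hc i; first by case: i.
apply: contrapT => hci; have [a ha e] := ext_gens hv hc.
have [|u hu] := m_unit (a := c i - a i).
  by move=> h; apply: hci; rewrite -(subrK (a i) (c i)); exact: submodD m_ideal h (ha i).
suff /hmin : has_gens psi n by rewrite ltnn.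
have hvi : v i = \sum_j psi (- (u * (c (lift i j) - a (lift i j)))) * v (lift i j).
  move/eqP: e; rewrite -subr_eq0 -sumrB (bigD1_ord i) //= => /eqP h.
  rewrite -[LHS]mul1r -(rmorph1 psi) -hu.
  under eq_bigr do rewrite rmorphN rmorphM mulNr -mulrA rmorphB mulrBl.
  rewrite sumrN -mulr_sumr -[X in - (_ * X)](addKr (psi (c i) * v i - psi (a i) * v i)) h.
  by rewrite rmorphM rmorphB; ring.
exists (fun j => v (lift i j)) => x; have [d ->] := hv x.
exists (fun j => d i * - (u * (c (lift i j) - a (lift i j))) + d (lift i j)).
rewrite (bigD1_ord i) //= [in LHS]hvi mulr_sumr -big_split; apply: eq_bigr => j _ /=.
by rewrite rmorphD rmorphM mulrDl mulrA.
Qed.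

Definition min_gens psi n := has_gens psi n /\ forall k, has_gens psi k -> (n <= k)%N.

Lemma min_gens_exists psi g : has_gens psi g -> exists n, min_gens psi n.
Proof.
move=> hg; have ex : exists n, `[< has_gens psi n >] by exists g; apply/asboolP.
case: (ex_minnP ex) => n /asboolP hn hmin; exists n; split=> // k hk.
by apply: hmin; apply/asboolP.
Qed.

Lemma min_gens_lenge psi n : min_gens psi n -> lenge psi (ext psi) n.
Proof.
move=> [[v hv] hmin]; rewrite -(addn0 n).
apply: (lenge_indep m_proper (V := setT) (v := v)) => //.
- exact: ideal_submod (ext_ideal psi).
- by move=> c; exact: min_gens_indep.
- exact: lenge0.
Qed.

Lemma gen_sum psi U (T : finType) (v : T -> A) (c : T -> A) : submod psi U ->
  gen psi U [seq v t | t : T] (\sum_t psi (c t) * v t).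
Proof.
move=> hU; have hg := gen_submod [seq v t | t : T] hU.
apply: (submod_sum hg) => t; apply: (submodM _ hg); apply: gen_mem => //.
exact: codom_f.
Qed.

Lemma has_gens_lenle psi n : has_gens psi n -> lenle m psi (ext psi) n.
Proof.
move=> [v hv]; have hU := ideal_submod psi (ext_ideal psi).
have := @lenle_gen _ m psi (ext psi) m [seq v t | t : 'I_n] 1 0 hU.
rewrite size_map size_enum_ord muln1 addn0; apply.
- by move=> x _ a ha; exact: ext_mem.
- apply: (@lenle_step _ _ _ _ 1) => [a /=|]; first by rewrite mulr1.
  by apply: lenle_full => x; exists x; rewrite /= mulr1 subrr; exact: submod0 m_ideal.
- by apply: lenle_full => x; have [c ->] := hv x; exact: gen_sum.
Qed.

(* Over psi, a copy of the residue field has length q. *)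
Lemma lenge_restrict psi q (r : 'I_q -> A) U N : indep m psi r -> is_ideal U ->
  lenge idfun U N -> lenge psi U (q * N).
Proof.
move=> hr + h; elim: h => {U N} [U _|U V x n hV hUV hx hUx hn IH hU].
  by rewrite muln0; apply: lenge0.
(* (U + Ax)/(U + mx) is a copy of the residue field, so the q elements r_j x remain independent
   modulo W = U + mx and refine the single step into q steps. *)
pose W := [set w | exists2 a, m a & U (w - a * x)].
have hUW : U `<=` W.
  by move=> w hw; exists 0; [exact: submod0 m_ideal|rewrite mul0r subr0].
have hUm c : U (c * x) -> m c.
  move=> hc; apply: contrapT => /m_unit [b hb]; apply: hUx.
  by rewrite -(mul1r x) -hb -mulrA; exact: (submodM b hU).
rewrite mulnS; apply: lenge_mono (hUW) _.
apply: (lenge_indep m_proper (V := V) (v := fun j => r j * x)) (IH hV).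
- split; first by apply: hUW; exact: submod0 hU.
  split=> [w z [a ha hw] [b hb hz]|s w [a ha hw]].
    exists (a + b); first exact: submodD m_ideal ha hb.
    by rewrite (_ : _ - _ = w - a * x + (z - b * x)); [exact: submodD hU hw hz|ring].
  exists (psi s * a); first exact: (submodM (f := idfun) _ m_ideal).
  by rewrite (_ : _ - _ = psi s * (w - a * x)); [exact: (submodM (f := idfun) _ hU)|ring].
- exact: ideal_submod hV.
- move=> w [a ha /hUV hw]; rewrite -(subrK (a * x) w).
  by apply: (submodD hV hw); exact: (submodM a hV).
- by move=> j; exact: (submodM (f := idfun) _ hV).
- move=> c [a ha]; under eq_bigr do rewrite mulrA.
  rewrite -mulr_suml -mulrBl => /hUm h; apply: hr.
  by rewrite -(subrK a (\sum_i _)); exact: submodD m_ideal h ha.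
Qed.

(** Each simple step is spanned through psi by the q elements r_t x, which psi(m) kills because psi
    maps m into m. Denominators outside m are units and can be divided out. *)
Lemma lenle_restrict psi q (r : 'I_q -> A) U N : (forall x, m x -> m (psi x)) ->
  torsion_span m psi r -> is_ideal U ->
  lenle m idfun U N -> lenle m psi U (q * N).
Proof.
move=> hpsi hr + h; elim: h => {U N} [U n hU _|U x n hx _ IH hU]; first exact: lenle_full.
have hUs := ideal_submod psi hU.
have := @lenle_gen _ m psi U m [seq r t * x | t : 'I_q] 1 (q * n) hUs.
rewrite size_map size_enum_ord muln1 mulnS; apply.
- move=> _ /mapP [j _ ->] a ha; rewrite mulrCA.
  by apply: (submodM (f := idfun) _ hU); apply: hx; exact: hpsi.
- apply: (@lenle_step _ _ _ _ 1) => [a /=|]; first by rewrite mulr1.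
  by apply: lenle_full => y; exists y; rewrite /= mulr1 subrr; exact: submod0 m_ideal.
apply: lenle_mono (IH (@adj_submod _ idfun U x hU)) => w [a hw] /=.
have [b [c [/m_unit [b' hb] hc]]] := hr a.
have hg := gen_submod [seq r t * x | t : 'I_q] hUs.
have hsum : gen psi U [seq r t * x | t : 'I_q] ((\sum_t psi (c t) * r t) * x).
  rewrite mulr_suml; under eq_bigr do rewrite -mulrA.
  exact: (gen_sum (fun t => r t * x) c).
rewrite -(subrK (a * x) w); apply: (submodD hg); first exact: gen_sub.
rewrite (_ : a * x = psi b' * (psi b * a - \sum_t psi (c t) * r t) * x +
    psi b' * ((\sum_t psi (c t) * r t) * x)).
  apply: (submodD hg); last exact: submodM hg hsum.
  by apply: gen_sub; apply: hx; exact: (submodM (f := idfun) _ m_ideal).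
have : psi b' * psi b = 1 by rewrite -rmorphM hb rmorph1.
by move=> e; rewrite -[in LHS](mul1r a) -e; ring.
Qed.

(** Chains of [lenge] may stop short of A while those of [ideal_chain_from] end there. Closing a
    chain up can only lengthen it, so the two maxima agree. *)
Lemma colength_eq I l : is_ideal I -> lenge idfun I l ->
  (forall N, lenge idfun I N -> (N <= l)%N) -> colength I = l.
Proof.
move=> hI hl hmax; apply: natmax_eq.
have up (J : set A) n : ideal_chain_from J n -> lenge idfun J n.
  elim: n J => [|n IH] J [F [<- [FT [Fi FS]]]]; first exact: lenge0.
  have [hs hne] := FS 0%N isT.
  have [x hx hx'] : exists2 x, F 1%N x & ~ F 0%N x.
    apply: contrapT => h; apply: hne; apply/seteqP; split=> // y hy.
    by apply: contrapT => hy'; apply: h; exists y.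
  apply: (@lenge_step _ _ _ (F 1%N) x) => //; first exact: Fi.
  apply: IH; exists (fun i => F i.+1); split=> //; split=> //; split=> i hi; first exact: Fi.
  exact: FS.
have down (J : set A) n : is_ideal J -> lenge idfun J n ->
    exists2 p, (n <= p)%N & ideal_chain_from J p.
  move=> + h; elim: h => {J n} [J hJ|J V x n hV hJV hx hJx _ IH hJ].
    have [->|hne] := pselect (J = setT).
      by exists 0%N => //; exists (fun=> setT); split=> //; split=> //; split.
    exists 1%N => //; exists (fun i => if i is 0 then J else setT).
    split=> //; split=> //; split; first by case=> [|i] _ //; split=> //; split.
    by case=> [|i] // _; split.
  have [p hp [F [F0 [FT [Fi FS]]]]] := IH hV.
  exists p.+1 => //; exists (fun i => if i is i'.+1 then F i' else J).
  split=> //; split=> //; split; first by case=> [|i] //; exact: Fi.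
  case=> [|i]; last exact: FS.
  by rewrite F0 => _; split=> // e; apply: hJx; rewrite e.
split; last by move=> k /up /hmax.
have [p hp hc] := down _ _ hI hl.
suff -> : l = p by [].
by apply/eqP; rewrite eqn_leq hp hmax //; exact: up.
Qed.

(* Both sides are the length of A/psi(m)A as a module through psi. *)
Lemma min_gens_colength psi q mu : (forall x, m x -> m (psi x)) -> (0 < q)%N ->
  has_basis m psi q -> min_gens psi mu -> (mu = q * colength (ext psi))%N.
Proof.
move=> hpsi q0 [r hr hr'] hmu.
have hU := ext_ideal psi; have hUs := ideal_submod psi hU.
have hle := has_gens_lenle (proj1 hmu).
have bd N : lenge idfun (ext psi) N -> (q * N <= mu)%N.
  by move=> /(lenge_restrict hr hU) h; exact: (lenge_le_lenle m_unit hUs h).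
have ex : exists N, `[< lenge idfun (ext psi) N >] by exists 0%N; apply/asboolP; apply: lenge0.
have bd' N : `[< lenge idfun (ext psi) N >] -> (N <= mu)%N.
  by move=> /asboolP /bd; apply: leq_trans; rewrite leq_pmull.
case: (ex_maxnP ex bd') => l /asboolP hl hmax.
have {}hmax N : lenge idfun (ext psi) N -> (N <= l)%N by move=> h; apply: hmax; apply/asboolP.
rewrite (colength_eq hU hl hmax); apply/eqP; rewrite eqn_leq bd // andbT.
have hl' := @lenle_of_max _ m m_ideal m_unit m_proper idfun _ _ hU hl hmax.
apply: (lenge_le_lenle m_unit hUs (min_gens_lenge hmu)).
exact: lenle_restrict.
Qed.

End MinimalGenerators.

(** * The Cohen-Macaulay bound *)

Section CohenMacaulay.
Variables (A : idomainType) (m : set A).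
Hypothesis noethA : noetherian A.
Hypothesis m_max : maximal_ideal m.
Hypothesis m_uniq : forall M : set A, maximal_ideal M -> M = m.
Implicit Types (I J P Q U : set A) (phi psi : {rmorphism A -> A}) (xs zs : seq A).

Let m_ideal : is_ideal m := maximal_idealP m_max.
Let m_proper : ~ m 1 := maximal_ideal1 m_max.
Let m_unit a : ~ m a -> exists b, b * a = 1 := maximal_unit noethA m_uniq (a := a).

Lemma zero_prime : prime_ideal [set (0 : A)].
Proof.
split; first exact: ideal0.
split=> [e|x y /= /eqP]; last by rewrite mulf_eq0 => /orP[]/eqP; [left|right].
have : [set (0 : A)] 1 by rewrite e.
by move=> /= /eqP; rewrite oner_eq0.
Qed.

(** Pulling back a prime chain of maximal length keeps it strict by incomparability. A nonzero
    kernel would put its first member strictly above the prime 0, giving a chain of length d + 1. *)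
Lemma finite_dim_injective phi g d : krull_dim_is A d -> has_gens phi g ->
  forall x, phi x = 0 -> x = 0.
Proof.
move=> [[P [pP sP]] hd] hg x hx; apply: contrapT => hx0.
suff /hd : prime_chain A d.+1 by rewrite ltnn.
exists (fun i => if i is i'.+1 then phi @^-1` P i' else [set 0]); split.
  by move=> [|i] hi; [exact: zero_prime|apply: prime_preim; exact: pP].
move=> [|i] hi.
  split=> [_ ->|e].
    by rewrite /= rmorph0; exact: submod0 (prime_idealP (pP 0%N isT)).
  apply: hx0; suff : [set 0] x by [].
  by rewrite e /= hx; exact: submod0 (prime_idealP (pP 0%N isT)).
have [hs hne] := sP i hi; have pPi := pP i (ltnW hi).
have hPi := prime_idealP (pP i.+1 hi).
split=> [y|e]; first exact: hs.
apply: hne; apply/seteqP; split=> // c hc; apply: contrapT => hc'.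
have [a [b [ha hab]]] := image_multiple pPi hg hc'.
apply: ha; rewrite -[P i (phi a)]/((phi @^-1` P i) a) e /=.
rewrite -(subrK (c * b) (phi a)); apply: (submodD hPi (hs _ hab)); exact: idealM.
Qed.

(** Incomparability again: an element of m outside Q would yield a unit a with psi(a) in m. *)
Lemma preim_max psi g Q : (forall x, m x -> m (psi x)) -> has_gens psi g ->
  prime_ideal Q -> psi @^-1` Q = m -> Q = m.
Proof.
move=> hpsi hg pQ e; have hQm := prime_sub_max noethA m_uniq pQ.
apply/seteqP; split=> // c hc; apply: contrapT => hc'.
have [a [b [ha hab]]] := image_multiple pQ hg hc'.
have [|a' ha'] := m_unit (a := a); first by rewrite -e.
apply: m_proper; rewrite -(rmorph1 psi) -ha' rmorphM.
apply: (submodM (f := idfun) _ m_ideal); rewrite -(subrK (c * b) (psi a)).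
by apply: (submodD m_ideal); [exact: hQm|exact: idealM].
Qed.

Lemma regular_seq_list d : regular_seq_in m d ->
  exists xs, [/\ size xs = d, regseq [set 0] xs & {in xs, forall x, m x}].
Proof.
move=> [x [hm hreg]].
pose y i := if insub i is Some j then x j else 0.
have yE (j : 'I_d) : y j = x j by rewrite /y valK.
exists [seq y i | i <- iota 0 d]; split.
- by rewrite size_map size_iota.
- pose I i := ideal_of [set x j | j in [set j : 'I_d | (j < i)%N]].
  have I0 : [set 0] = I 0%N.
    apply/seteqP; split=> [_ ->|]; first exact: submod0 (ideal_of_ideal _).
    by apply: ideal_of_min; [exact: ideal0|move=> z [j /=]; rewrite ltn0].
  suff H k i : (i + k = d)%N -> regseq (I i) [seq y j | j <- iota i k] by rewrite I0; exact: H.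
  elim: k i => [|k IH] i // e; have hi : (i < d)%N by rewrite -e addnS ltnS leq_addr.
  have yi : y i = x (Ordinal hi) := yE (Ordinal hi).
  split; first by move=> t; rewrite yi; exact: hreg (Ordinal hi) t.
  have -> : adj idfun (I i) (y i) = I i.+1; last by apply: IH; rewrite addSnnS.
  have hS := ideal_of_ideal [set x j | j in [set j : 'I_d | (j < i.+1)%N]].
  apply/seteqP; split.
    apply: (@adj_min _ idfun) => //.
      apply: ideal_of_min => // _ [j /= hj <-]; apply: ideal_of_mem.
      by exists j => //=; exact: ltnW.
    by apply: ideal_of_mem; exists (Ordinal hi) => //=.
  have hT := @adj_submod _ idfun _ (y i) (ideal_of_ideal [set x j | j in [set j : 'I_d | (j < i)%N]]).
  apply: ideal_of_min => // _ [j /= hj <-].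
  move: hj; rewrite ltnS leq_eqVlt => /orP[/eqP ej|hj].
    rewrite (_ : x j = y i); last by rewrite -ej yE.
    apply: (@adj_mem _ idfun); exact: ideal_of_ideal.
  by apply: (@adj_sub _ idfun); apply: ideal_of_mem; exists j.
- move=> z /mapP [i]; rewrite mem_iota add0n => /= hi ->.
  by rewrite (yE (Ordinal hi)).
Qed.

(** For [zs] inside m this says that the radical of (zs) is m. In terms of primes, the property
    passes at once to powers and to images under psi. *)
Definition primary zs := forall Q, prime_ideal Q -> {in zs, forall z, Q z} -> Q = m.

Section RegularSystem.
Variables (d : nat) (xs : seq A).
Hypothesis dimA : krull_dim_is A d.
Hypothesis xs_size : size xs = d.
Hypothesis xs_reg : regseq [set 0] xs.
Hypothesis xs_m : {in xs, forall x, m x}.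

Lemma xs_primary : primary xs.
Proof. by move=> Q pQ; exact: regseq_prime_max xs_reg xs_size pQ. Qed.

(** In a Cohen-Macaulay ring every system of parameters is regular in any order. Some power of each
    x of the known regular sequence lies in (z :: zs), since a prime over this ideal avoiding the
    powers of x would be m, which contains x. *)
Lemma parameter_regular z zs : size (z :: zs) = d -> primary (z :: zs) ->
  forall y, gen idfun [set 0] zs (z * y) -> gen idfun [set 0] zs y.
Proof.
move=> hsz hzs; apply: (koszul_regular xs_reg); first by rewrite xs_size -hsz.
move=> x hx; apply: contrapT => hN.
have hg : is_ideal (gen idfun [set 0] (z :: zs)) := @gen_submod _ idfun _ _ (ideal0 A).
have [|||P [pP hzP hPS]] := @prime_avoiding A noethA _ [set y | exists n, y = x ^+ n] hg.
- by exists 0%N; rewrite expr0.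
- by move=> _ _ [i ->] [j ->]; exists (i + j)%N; rewrite exprD.
- by move=> y hy [n e]; apply: hN; exists n; rewrite -e.
apply: (hPS x); last by exists 1%N.
rewrite (hzs P pP); first exact: xs_m.
by move=> y hy; apply: hzP; exact: (@gen_mem _ idfun _ _ _ (ideal0 A)).
Qed.

(** At each stage z must be regular modulo a list with some entries raised to the power k; that list
    together with z still has d entries and m as its only prime, so [parameter_regular] applies. *)
Lemma lenge_gen_exp psi s t N k : (0 < k)%N -> size (s ++ t) = d -> primary (s ++ t) ->
  lenge psi (gen idfun [set 0] (s ++ t)) N ->
  lenge psi (gen idfun [set 0] ([seq z ^+ k | z <- s] ++ t)) (k ^ size s * N).
Proof.
move=> hk; elim: s t => [|z s IH] t; first by rewrite mul1n.
move=> hsz hp; have h0 : submod (idfun : {rmorphism A -> A}) [set (0 : A)] := ideal0 A.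
rewrite -[(z :: s) ++ t]/(z :: s ++ t) -gen_cat_cons // => h.
have {}IH : lenge psi (gen idfun [set 0] (z :: [seq z ^+ k | z <- s] ++ t)) (k ^ size s * N).
  rewrite -gen_cat_cons //; apply: IH => //.
    by rewrite -hsz !size_cat /= addnS.
  by move=> Q pQ hQ; apply: hp => // y hy; apply: hQ; move: hy;
      rewrite !(mem_cat, inE) => /orP[/orP[]|] ->; rewrite ?orbT.
rewrite expnS -mulnA; apply: lenge_adj_exp IH; first exact: gen_submod.
apply: parameter_regular; first by rewrite -hsz /= !size_cat size_map.
move=> Q pQ hQ; apply: hp => // y; rewrite inE mem_cat => /or3P [/eqP ->|hy|hy].
- by apply: hQ; exact: mem_head.
- apply: (prime_idealX (n := k) pQ); apply: hQ.
  by rewrite inE mem_cat (map_f (fun z => z ^+ k) hy) orbT.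
- by apply: hQ; rewrite inE mem_cat hy !orbT.
Qed.

(** Primes containing c lie strictly above the prime 0, so chains starting at them are shorter than
    d. *)
Lemma growth_nonzero c : c != 0 -> growth m d (adj idfun [set 0] c) xs.
Proof.
move=> hc; apply: growth_of_primes => //; first exact: (@adj_submod _ idfun _ _ (ideal0 A)).
move=> Q pQ hQ; apply: growth_prime => //; first exact: xs_primary.
move=> n hn; case: dimA => _; apply; apply: (@prime_chain_from_chain _ [set 0]).
apply: (prime_chain_fromS zero_prime _ _ hn).
  by move=> _ ->; exact: submod0 (prime_idealP pQ).
move=> e; have : Q c by apply: hQ; exact: (@adj_mem _ idfun _ _ (ideal0 A)).
by rewrite -e => /eqP; apply/negP.
Qed.

(* A free submodule of rank D, with g cyclic torsion quotients on top of it: the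
   latter contribute one power of k less. *)
Lemma lenle_pushforward psi D g e : has_basis [set 0] psi D -> has_gens psi g ->
  lenle m idfun (gen idfun [set 0] xs) e ->
  exists C, forall k, (0 < k)%N -> exists2 h, (k * h <= C * k ^ d)%N &
    lenle m psi (gen idfun [set 0] [seq z ^+ k | z <- [seq psi x | x <- xs]])
      (D * (k ^ d * e) + g * h).
Proof.
move=> [r _ hr] [s hs] he.
have /choice [c /choice [w hcw]] j := hr (s j).
(* A common denominator: psi(c0) carries every generator s_j into the span of the r_t, so each of
   the g cyclic quotients on top is a quotient of A/(c0). *)
pose c0 := \prod_j c j.
have hc0 : c0 != 0 by apply/prodf_neq0 => j _; apply/eqP; case: (hcw j).
have [C hC] := growth_nonzero hc0; exists C => k hk; have [h hh bh] := hC k hk.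
exists h => //; set U0 := gen _ _ _.
have hU0 : is_ideal U0 := @gen_submod _ idfun _ _ (ideal0 A).
have hU0s := ideal_submod psi hU0.
have hpow x y : x \in [seq z ^+ k | z <- xs] -> U0 (psi x * y).
  move=> /mapP [z hz ->]; apply: idealM => //; rewrite rmorphXn.
  by apply: (@gen_mem _ idfun _ _ _ (ideal0 A)); apply: map_f; exact: map_f.
have hpre U y : submod psi U -> is_ideal [set a | U (psi a * y)].
  move=> hU; split; first by rewrite /= rmorph0 mul0r; exact: submod0 hU.
  split=> [a b|a b] /=; first by rewrite rmorphD mulrDl; exact: submodD hU.
  by rewrite rmorphM -mulrA; exact: submodM.
have := @lenle_gen _ m psi U0 (gen idfun [set 0] [seq z ^+ k | z <- xs])
  [seq r t | t : 'I_D] (k ^ d * e) (g * h) hU0s.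
rewrite size_map size_enum_ord; apply.
- move=> y _; apply: (@gen_min _ idfun _ [set a | U0 (psi a * y)]); first exact: hpre.
    by move=> _ ->; rewrite /= rmorph0 mul0r; exact: submod0 hU0.
  by move=> x hx; exact: hpow.
- have := @lenle_gen_exp _ m [set 0] xs [::] e k (ideal0 A).
  by rewrite !cats0 xs_size; apply.
have hU1 := gen_submod [seq r t | t : 'I_D] hU0s.
have := @lenle_gen _ m psi _ (gen idfun (adj idfun [set 0] c0) [seq z ^+ k | z <- xs])
  [seq s t | t : 'I_g] h 0 hU1.
rewrite size_map size_enum_ord addn0; apply => //; last first.
  by apply: lenle_full => x; have [b ->] := hs x; exact: gen_sum.
move=> y /mapP [j _ ->]; set U1 := gen psi U0 _ in hU1 *.
apply: (@gen_min _ idfun _ [set a | U1 (psi a * s j)]); first exact: hpre.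
  apply: (@adj_min _ idfun); first exact: hpre.
    by move=> _ ->; rewrite /= rmorph0 mul0r; exact: submod0 hU1.
  rewrite /= /c0 (bigD1 j) //= [c j * _]mulrC rmorphM -mulrA; apply: (submodM _ hU1).
  case: (hcw j) => _ /eqP; rewrite subr_eq0 => /eqP ->.
  exact: gen_sum.
by move=> x hx; apply: gen_sub; exact: hpow.
Qed.

(* Compare k^d mu <= length of A/(psi(x)^k) <= k^d D e + O(k^(d-1)). *)
Lemma min_gens_le_rank psi D g e mu : (forall x, m x -> m (psi x)) ->
  has_basis [set 0] psi D -> has_gens psi g -> min_gens psi mu ->
  lenle m idfun (gen idfun [set 0] xs) e -> (mu <= D * e)%N.
Proof.
move=> hpsi hD hg hmu he; have [C hC] := lenle_pushforward hD hg he.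
have hle k : (0 < k)%N -> (k * mu <= k * (D * e) + g * C)%N.
  move=> hk; have [h bh hh] := hC k hk.
  have h0 : is_ideal (gen idfun [set 0] [seq z ^+ k | z <- [seq psi x | x <- xs]]).
    exact: (@gen_submod _ idfun _ _ (ideal0 A)).
  have hge : lenge psi (gen idfun [set 0] [seq z ^+ k | z <- [seq psi x | x <- xs]]) (k ^ d * mu).
    have := @lenge_gen_exp psi [seq psi x | x <- xs] [::] mu k hk.
    rewrite !cats0 size_map xs_size; apply => //.
      move=> Q pQ hQ; apply: (preim_max hpsi hg pQ).
      by apply: xs_primary; [exact: prime_preim|move=> x hx; apply: hQ; exact: map_f].
    (* The elements psi(x) lie in psi(m)A, so the quotient by them is at least as long as the fibre,
       whose length through psi is mu. *)
    apply: lenge_mono (min_gens_lenge m_ideal m_unit m_proper hmu).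
    apply: (@gen_min _ idfun); first exact: ext_ideal.
      by move=> _ ->; exact: submod0 (ext_ideal _ _).
    by move=> _ /mapP [x hx ->]; rewrite -[psi x]mulr1; apply: ext_mem; exact: xs_m.
  have := lenge_le_lenle m_unit (ideal_submod psi h0) hge hh.
  have : (0 < k ^ d)%N by rewrite expn_gt0 hk.
  (* With K = k^d, the bound K mu <= D K e + g h is multiplied by k, k h is replaced by C K, and K
     is cancelled. *)
  move: (k ^ d)%N bh => K bh K0 hK; rewrite -(leq_pmul2l K0); nia.
(* If mu exceeded D e, [hle] would give k <= g C, which k = g C + 1 violates. *)
by have := hle (g * C).+1 isT; nia.
Qed.

End RegularSystem.

End CohenMacaulay.

(** * Entropy *)

(** Fekete's lemma, with the infimum of u n / n as limit: n is divided by a nearly optimal index K +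
    1, and the remainder contributes a bounded amount. *)
Lemma subadditive_cvg (RR : realType) (u : nat -> RR) :
  (forall n, 0 <= u n) -> (forall a b, u (a + b)%N <= u a + u b) ->
  cvgn (fun n => u n / n%:R).
Proof.
(* Indices start at 1 because u 0 / 0 is 0 by convention and would spoil the infimum. *)
move=> u0 uD; pose E := [set u n.+1 / n.+1%:R | n in setT].
have E0 : has_inf E.
  split; first by exists (u 1%N / 1%:R); exists 0%N.
  by exists 0 => _ [n _ <-]; apply: divr_ge0.
apply/cvg_ex; exists (inf E); apply/cvgrPdist_le => eps eps0.
have eps20 : 0 < eps / 2 by rewrite divr_gt0.
have [_ [K _ <-] hK] := inf_adherent eps20 E0.
have uM q r : u (q * K.+1 + r)%N <= q%:R * u K.+1 + u r.
  elim: q => [|q IH]; first by rewrite mul0n mul0r add0r.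
  by rewrite mulSn -addnA; apply: le_trans (uD _ _) _; rewrite mulrS mulrDl mul1r -addrA lerD2l.
(* B bounds u at every remainder r <= K, as u r <= u 0 + r u 1; the threshold on n below makes B / n
   at most eps / 2. *)
pose B := u 0%N + K%:R * u 1%N.
have uB r : (r < K.+1)%N -> u r <= B.
  move=> hr; have h : u r <= u 0%N + r%:R * u 1%N.
    elim: r {hr} => [|r IH]; first by rewrite mul0r addr0.
    by rewrite -addn1; apply: le_trans (uD _ _) _; rewrite natrD mulrDl mul1r addrA lerD2r.
  by apply: le_trans h _; rewrite /B lerD2l ler_wpM2r // ler_nat -ltnS.
have B0 : 0 <= B by rewrite /B addr_ge0 // mulr_ge0.
exists (Num.truncn (B / (eps / 2))).+1 => // n /= hn.
have n0 : (0 < n)%N by apply: leq_trans hn.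
have hge : inf E <= u n / n%:R.
  by apply: ge_inf; [case: E0|exists n.-1; rewrite ?prednK].
have npos : 0 < n%:R :> RR by rewrite ltr0n.
rewrite ler0_norm ?subr_le0 // opprB lerBlDl.
have hBn : B <= n%:R * (eps / 2).
  rewrite -ler_pdivrMr ?divr_gt0 //; apply: ltW.
  apply: lt_le_trans (truncnS_gt _) _.
  by rewrite ler_nat.
rewrite ler_pdivrMr //; apply: le_trans (_ : (n %/ K.+1)%:R * u K.+1 + B <= _).
  rewrite {1}(divn_eq n K.+1); apply: le_trans (uM _ _) _.
  by rewrite lerD2l; apply: uB; rewrite ltn_mod.
have h1 : (n %/ K.+1)%:R * u K.+1 <= n%:R * (u K.+1 / K.+1%:R).
  rewrite mulrA mulrAC ler_wpM2r // ler_pdivlMr ?ltr0n // -natrM ler_nat.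
  exact: leq_divM.
have h2 : n%:R * (u K.+1 / K.+1%:R) <= n%:R * (inf E + eps / 2).
  by rewrite ler_wpM2l // ltW.
apply: le_trans (lerD (le_trans h1 h2) hBn) _.
by rewrite -mulrDr -addrA -splitr mulrC.
Qed.

Section Entropy.
Variables (RR : realType) (A : idomainType) (m : set A) (phi : {rmorphism A -> A}).
Hypothesis noethA : noetherian A.
Hypothesis m_max : maximal_ideal m.
Hypothesis m_uniq : forall M : set A, maximal_ideal M -> M = m.
Hypothesis phi_finite : finite_map phi.
Hypothesis phi_local : forall x, m x -> m (phi x).

Let m_ideal : is_ideal m := maximal_idealP m_max.
Let m_proper : ~ m 1 := maximal_ideal1 m_max.
Let m_unit a : ~ m a -> exists b, b * a = 1 := maximal_unit noethA m_uniq (a := a).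

Lemma res_basis : has_basis m phi (res_deg m phi).
Proof.
have [g hg] := phi_finite.
exact: (basis_natmax (maximal_prime noethA m_max m_uniq) phi_local hg).
Qed.

Lemma deg_basis : has_basis [set 0] phi (deg phi).
Proof.
have [g hg] := phi_finite.
by apply: basis_natmax hg; [exact: zero_prime|move=> _ ->; exact: rmorph0].
Qed.

Lemma res_deg_gt0 : (0 < res_deg m phi)%N.
Proof.
have [v _ hv] := res_basis; rewrite lt0n; apply/eqP => e.
have [a [c [/m_unit [b hb]]]] := hv 1.
rewrite mulr1 big1 => [|i]; last by have := ltn_ord i; rewrite [X in (_ < X)%N]e.
rewrite subr0 => ha; apply: m_proper; rewrite -(rmorph1 phi) -hb rmorphM.
exact: (submodM (f := idfun) _ m_ideal).
Qed.

Lemma lambda_ext n : lambda m phi n = colength (ext m (iterm phi n)).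
Proof.
by rewrite /lambda /ext; congr (colength (ideal_of (image _ _))); apply/funext => x; rewrite itermE.
Qed.

Section MinGens.
Variable mu : nat -> nat.
Hypothesis mu_min : forall n, min_gens (iterm phi n) (mu n).

Lemma mu_lambda n : (mu n = res_deg m phi ^ n * lambda m phi n)%N.
Proof.
have [g hg] := phi_finite; rewrite lambda_ext.
apply: (min_gens_colength m_ideal m_unit m_proper _ _ _ (mu_min n)).
- exact: iterm_closed.
- by rewrite expn_gt0 res_deg_gt0.
- exact: (has_basis_iterm n (maximal_prime noethA m_max m_uniq) phi_local hg res_basis).
Qed.

Lemma mu_gt0 n : (0 < mu n)%N.
Proof.
have [[v hv] _] := mu_min n; rewrite lt0n; apply/eqP => e.
have [c] := hv 1; rewrite big1 => [/eqP|i]; first by rewrite oner_eq0.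
by have := ltn_ord i; rewrite [X in (_ < X)%N]e.
Qed.

Lemma mu_submul a b : (mu (a + b) <= mu a * mu b)%N.
Proof.
have [_] := mu_min (a + b); apply.
have -> : (iterm phi (a + b) : A -> A) = iterm phi a \o iterm phi b.
  by apply/funext => x /=; rewrite !itermE iterD.
by apply: has_gens_comp; [case: (mu_min a)|case: (mu_min b)].
Qed.

Lemma deg_le_mu n : (deg phi ^ n <= mu n)%N.
Proof.
have [g hg] := phi_finite; have [hn _] := mu_min n.
have h0 x : [set (0 : A)] x -> [set (0 : A)] (phi x) by move=> ->; exact: rmorph0.
have [v hv _] := has_basis_iterm n (zero_prime A) h0 hg deg_basis.
by apply: indep_le_gens hn hv; [exact: zero_prime|exact: iterm_closed].
Qed.

Lemma mu_cvg : cvgn (fun n => ln ((mu n)%:R : RR) / n%:R).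
Proof.
apply: subadditive_cvg => [n|a b]; first by rewrite ln_ge0 // ler1n mu_gt0.
rewrite -lnM ?posrE ?ltr0n ?mu_gt0 // -natrM ler_ln ?posrE ?ltr0n ?muln_gt0 ?mu_gt0 //.
by rewrite ler_nat mu_submul.
Qed.

Lemma h_alg_mu : h_alg RR m phi =
  limn (fun n => ln ((mu n)%:R : RR) / n%:R) - ln (res_deg m phi)%:R.
Proof.
apply: cvg_lim => //.
have h : (fun n => ln ((mu n)%:R : RR) / n%:R - ln (res_deg m phi)%:R) @ \oo -->
    limn (fun n => ln ((mu n)%:R : RR) / n%:R) - ln (res_deg m phi)%:R.
  by apply: cvgB; [exact: mu_cvg|exact: cvg_cst].
(* The identity requires n > 0: at n = 0 the quotients are 0 and the constant ln [phi_* k : k] is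
   left over. *)
apply: cvg_trans h; apply: near_eq_cvg; exists 1%N => // n /= n0.
have l0 : (0 < lambda m phi n)%N by have := mu_gt0 n; rewrite mu_lambda muln_gt0 => /andP[].
rewrite mu_lambda natrM lnM ?posrE ?ltr0n ?expn_gt0 ?res_deg_gt0 // natrX.
rewrite lnXn ?ltr0n ?res_deg_gt0 // mulrDl -[_ *+ n]mulr_natr mulfK ?pnatr_eq0 -?lt0n //.
by rewrite addrAC subrr add0r.
Qed.

Lemma ln_deg_le : ln ((deg phi)%:R : RR) <= limn (fun n => ln ((mu n)%:R : RR) / n%:R).
Proof.
apply: limr_ge; first exact: mu_cvg.
exists 1%N => // n /= n0.
(* For rank 0 the logarithm is 0 by convention, and the terms on the right are nonnegative. *)
have [->|d0] := posnP (deg phi).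
  by rewrite ln0 // divr_ge0 // ln_ge0 // ler1n mu_gt0.
rewrite ler_pdivlMr ?ltr0n // mulr_natr -lnXn ?ltr0n // -natrX.
by rewrite ler_ln ?posrE ?ltr0n ?expn_gt0 ?d0 ?mu_gt0 // ler_nat deg_le_mu.
Qed.

Lemma ln_deg_eq : cohen_macaulay m ->
  ln ((deg phi)%:R : RR) = limn (fun n => ln ((mu n)%:R : RR) / n%:R).
Proof.
move=> [d [hd [/regular_seq_list [xs [xs_size xs_reg xs_m]] _]]].
have [g hg] := phi_finite.
(* Rank 0 would make 1 a torsion element, so phi(a) = 0 for some a other than 0, against
   injectivity. *)
have d0 : (0 < deg phi)%N.
  have [v _ hv] := deg_basis; rewrite lt0n; apply/eqP => e.
  have [a [c [ha]]] := hv 1.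
  rewrite mulr1 big1 => [|i]; last by have := ltn_ord i; rewrite [X in (_ < X)%N]e.
  by rewrite subr0 => /(finite_dim_injective hd hg).
have hJ : is_ideal (gen idfun [set 0] xs) := @gen_submod _ idfun _ _ (ideal0 A).
(* Here e is any bound for the length of A/(xs), fixed before n is chosen. *)
have [|e he] := lenle_finite noethA m_max hJ.
  move=> Q pQ hQ; apply: (xs_primary noethA m_max m_uniq hd xs_size xs_reg pQ).
  by move=> x hx; apply: hQ; exact: (@gen_mem _ idfun _ _ _ (ideal0 A)).
have h0 x : [set (0 : A)] x -> [set (0 : A)] (phi x) by move=> ->; exact: rmorph0.
have hmu n : (mu n <= deg phi ^ n * e)%N.
  have hD := has_basis_iterm n (zero_prime A) h0 hg deg_basis.
  have hm := iterm_closed n phi_local.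
  exact: (min_gens_le_rank noethA m_max m_uniq hd xs_size xs_reg xs_m hm hD
    (has_gens_iterm n hg) (mu_min n) he).
have e0 : (0 < e)%N by have := leq_trans (mu_gt0 0) (hmu 0%N); rewrite muln_gt0 => /andP[].
(* The shift removes n = 0; from deg^n <= mu_n <= e deg^n, the shifted term at n lies between ln deg
   and ln deg + ln e / (n + 1). *)
apply/esym/cvg_lim => //; rewrite -cvg_shiftS.
apply: (squeeze_cvgr (f := fun=> ln (deg phi)%:R)
  (h := fun n => ln (deg phi)%:R + ln e%:R * harmonic n)).
- apply: nearW => n.
  rewrite ler_pdivlMr ?ltr0n // mulr_natr -lnXn ?ltr0n // -natrX.
  rewrite ler_ln ?posrE ?ltr0n ?expn_gt0 ?d0 ?mu_gt0 // ler_nat deg_le_mu /=.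
  rewrite ler_pdivrMr ?ltr0n // mulrDl -mulrA mulVf ?pnatr_eq0 // mulr1 mulr_natr.
  rewrite -lnXn ?ltr0n // -natrX -lnM ?posrE ?ltr0n ?expn_gt0 ?d0 // -natrM.
  by rewrite ler_ln ?posrE ?ltr0n ?muln_gt0 ?expn_gt0 ?d0 ?mu_gt0 // ler_nat.
- exact: cvg_cst.
- rewrite -[X in _ --> X]addr0 -[X in _ --> _ + X](mulr0 (ln e%:R)).
  by apply: cvgD; [exact: cvg_cst|apply: cvgMr; exact: cvg_harmonic].
Qed.

End MinGens.
End Entropy.

Theorem mainTheorem19 (RR : realType) (A : idomainType) (m : set A)
  (phi : {rmorphism A -> A}) :
  noetherian A ->
  maximal_ideal m -> (forall M : set A, maximal_ideal M -> M = m) ->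
  finite_map phi -> phi @` m `<=` m ->
  (ln ((deg phi)%:R : RR) <= ln ((res_deg m phi)%:R : RR) + h_alg RR m phi) /\
  (cohen_macaulay m ->
   ln ((deg phi)%:R : RR) = ln ((res_deg m phi)%:R : RR) + h_alg RR m phi).
Proof.
move=> noethA m_max m_uniq phi_finite phi_m.
have phi_local x : m x -> m (phi x) by move=> hx; apply: phi_m; exists x.
have [g hg] := phi_finite.
have /choice [mu mu_min] n : exists k, min_gens (iterm phi n) k.
  exact: min_gens_exists (has_gens_iterm n hg).
rewrite (h_alg_mu RR noethA m_max m_uniq phi_finite phi_local mu_min) addrC subrK.
split; first exact: ln_deg_le.
exact: ln_deg_eq.
Qed.
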